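(* Let $Q$ be a quadratic form on $\Lambda_{\mathbb{R}} = \Lambda\otimes\mathbb{R}$, and assume that the stability condition $\sigma=(Z,\mathcal{P})\in \mathrm{Stab}_\Lambda(\mathcal{D})$ satisfies the support property with respect to $Q$. Then there is an open neighbourhood $U_\sigma$ of $\sigma$ in $\mathrm{Stab}_\Lambda(\mathcal{D})$ such that: (1) the restriction $\mathcal{Z}\colon U_\sigma\to \mathrm{Hom}(\Lambda,\mathbb{C})$ is a covering of the set of all $Z'\in\mathrm{Hom}(\Lambda,\mathbb{C})$ such that $Q$ is negative definite on $\mathrm{Ker}\, Z'\subset\Lambda_{\mathbb{R}}$; and (2) all stability conditions in $U_\sigma$ satisfy the support property with respect to $Q$.
   Context: $\mathcal{D}$ is a triangulated category with a group homomorphism $v\colon K(\mathcal{D})\to\Lambda$ from its K-group to a finitely generated free abelian group $\Lambda\cong\mathbb{Z}^m$; $\Lambda_{\mathbb{R}}=\Lambda\otimes\mathbb{R}$. For $Z\in\mathrm{Hom}(\Lambda,\mathbb{C})$ we write $Z(E)$ for $Z(v(E))$; $\mathrm{Ker}\,Z$ denotes the kernel of the $\mathbb{R}$-linear extension $\Lambda_{\mathbb{R}}\to\mathbb{C}$. Slicing: a collection $\mathcal{P}$ of full subcategories $\mathcal{P}(\phi)\subset\mathcal{D}$, $\phi\in\mathbb{R}$, such that (i) $\mathcal{P}(\phi+1)=\mathcal{P}(\phi)[1]$; (ii) for $\phi_1>\phi_2$ and $E_i\in\mathcal{P}(\phi_i)$ we have $\mathrm{Hom}(E_1,E_2)=0$;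 (iii) every $E\in\mathcal{D}$ has a sequence of maps $0=E_0\to E_1\to\dots\to E_m=E$ and reals $\phi_1>\dots>\phi_m$ such that the cone of $E_{j-1}\to E_j$ lies in $\mathcal{P}(\phi_j)$ (Harder-Narasimhan (HN) filtration). Non-zero objects of $\mathcal{P}(\phi)$ are called semistable of phase $\phi$. Pre-stability condition: a pair $\sigma=(Z,\mathcal{P})$ with $Z\colon\Lambda\to\mathbb{C}$ a group homomorphism and $\mathcal{P}$ a slicing, such that $Z(E)\in\mathbb{R}_{>0}\cdot e^{i\pi\phi}$ for all $0\neq E\in\mathcal{P}(\phi)$. Support property with respect to a quadratic form $Q\colon\Lambda_{\mathbb{R}}\to\mathbb{R}$: (a) $\mathrm{Ker}\,Z\subset\Lambda_{\mathbb{R}}$ is negative definite with respect to $Q$; (b) $Q(v(E))\ge0$ for every semistable object $E$. A stability condition is a pre-stability condition satisfying the support property with respect to some quadratic form. $\mathrm{Stab}_\Lambda(\mathcal{D})$ is the set of stability conditions. Topology: for slicings $\mathcal{P},\mathcal{Q}$ and $0\neq E\in\mathcal{D}$ let $\phi^{\pm}(E)$, $\psi^{\pm}(E)$ be the largest ($+$) and smallest ($-$) phases of the non-zero HN factors of $E$ with respect to $\mathcal{P}$, $\mathcal{Q}$, respectively. The generalised metric $d(\mathcal{P},\mathcal{Q})=\sup_{0\ne E\in\mathcal{D}}\{|\phi^+(E)-\psi^+(E)|,|\phi^-(E)-\psi^-(E)|\}\in[0,+\infty]$ defines a topology on the set of slicings. $\mathrm{Stab}_\Lambda(\mathcal{D})$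 has the coarsest topology such that $(Z,\mathcal{P})\mapsto\mathcal{P}$ and $\mathcal{Z}\colon(Z,\mathcal{P})\mapsto Z\in\mathrm{Hom}(\Lambda,\mathbb{C})\cong\mathbb{C}^m$ are both continuous. Convention: a map $X\to Y$ is a covering of $Y$ if every point of $Y$ has an evenly covered neighbourhood; fibres are allowed to be empty (over connected components of $Y$ not met by the image). *)

(* Defs.v *)
From HB Require Import structures.
From mathcomp Require Import all_boot all_order all_algebra.
From mathcomp Require Import freeg complex.
From mathcomp Require Import all_classical all_reals ereal topology normedtype.
From mathcomp Require Import trigo.

Set Implicit Arguments.
Unset Strict Implicit.
Unset Printing Implicit Defensive.

Import Order.TTheory GRing.Theory Num.Theory.
Import numFieldNormedType.Exports.

Local Open Scope classical_set_scope.
Local Open Scope ring_scope.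

Record preadditive := Preadditive {
  obj :> Type;
  hom : obj -> obj -> zmodType;
  idm : forall A, hom A A;
  comp : forall A B C, hom B C -> hom A B -> hom A C;
  compA : forall A B C E (h : hom C E) (g : hom B C) (f : hom A B),
    comp h (comp g f) = comp (comp h g) f;
  comp1m : forall A B (f : hom A B), comp (idm B) f = f;
  compm1 : forall A B (f : hom A B), comp f (idm A) = f;
  compDl : forall A B C (g1 g2 : hom B C) (f : hom A B),
    comp (g1 + g2) f = comp g1 f + comp g2 f;
  compDr : forall A B C (g : hom B C) (f1 f2 : hom A B),
    comp g (f1 + f2) = comp g f1 + comp g f2 }.

Arguments hom {p} A B.
Arguments idm {p} A.
Arguments comp {p A B C} g f.

Section Preadditive.
Variable D : preadditive.

Definition is_zero (E : D) :=
  (forall A (f : hom A E), f = 0) /\ (forall A (f : hom E A), f = 0).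

Definition is_iso (A B : D) (f : hom A B) :=
  exists g : hom B A, comp g f = idm A /\ comp f g = idm B.

Definition isomorphic (A B : D) := exists f : hom A B, is_iso f.

Definition is_biproduct (A B S : D) :=
  exists (i1 : hom A S) (i2 : hom B S) (p1 : hom S A) (p2 : hom S B),
  [/\ comp p1 i1 = idm A, comp p2 i2 = idm B, comp p1 i2 = 0, comp p2 i1 = 0
    & comp i1 p1 + comp i2 p2 = idm S].

End Preadditive.

(* The shift is an additive autoequivalence, not necessarily an automorphism. *)

Record triangulated := Triangulated {
  tcat :> preadditive;
  has_zero : exists Z : tcat, is_zero Z;
  has_biproduct : forall A B : tcat, exists S : tcat, is_biproduct A B S;
  shift : tcat -> tcat;
  shiftm : forall A B : tcat, hom A B -> hom (shift A) (shift B);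
  shiftm1 : forall A : tcat, shiftm (idm A) = idm (shift A);
  shiftmM : forall (A B C : tcat) (g : hom B C) (f : hom A B),
    shiftm (comp g f) = comp (shiftm g) (shiftm f);
  shiftmD : forall (A B : tcat) (f g : hom A B),
    shiftm (f + g) = shiftm f + shiftm g;
  shift_ff : forall A B : tcat, bijective (@shiftm A B);
  shift_es : forall A : tcat, exists B : tcat, isomorphic A (shift B);
  (* distinguished triangles A -f-> B -g-> C -h-> A[1] *)
  dist : forall A B C : tcat,
    hom A B -> hom B C -> hom C (shift A) -> Prop;
  dist_iso : forall (A B C A' B' C' : tcat)
      (f : hom A B) (g : hom B C) (h : hom C (shift A))
      (f' : hom A' B') (g' : hom B' C') (h' : hom C' (shift A'))
      (a : hom A A') (b : hom B B') (c : hom C C'),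
    is_iso a -> is_iso b -> is_iso c ->
    comp b f = comp f' a -> comp c g = comp g' b ->
    comp (shiftm a) h = comp h' c ->
    dist f g h -> dist f' g' h';
  dist_id : forall A Z : tcat, is_zero Z ->
    dist (idm A) (0 : hom A Z) (0 : hom Z (shift A));
  dist_ex : forall (A B : tcat) (f : hom A B),
    exists (C : tcat) (g : hom B C) (h : hom C (shift A)), dist f g h;
  dist_rot : forall (A B C : tcat)
      (f : hom A B) (g : hom B C) (h : hom C (shift A)),
    dist f g h <-> dist g h (- shiftm f);
  dist_mor : forall (A B C A' B' C' : tcat)
      (f : hom A B) (g : hom B C) (h : hom C (shift A))
      (f' : hom A' B') (g' : hom B' C') (h' : hom C' (shift A'))
      (a : hom A A') (b : hom B B'),
    dist f g h -> dist f' g' h' -> comp b f = comp f' a ->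
    exists c : hom C C',
      comp c g = comp g' b /\ comp (shiftm a) h = comp h' c;
  dist_octa : forall (X Y Z Q1 Q2 Q3 : tcat) (f : hom X Y) (g : hom Y Z)
      (p1 : hom Y Q1) (d1 : hom Q1 (shift X))
      (p2 : hom Z Q2) (d2 : hom Q2 (shift X))
      (p3 : hom Z Q3) (d3 : hom Q3 (shift Y)),
    dist f p1 d1 -> dist (comp g f) p2 d2 -> dist g p3 d3 ->
    exists (a : hom Q1 Q2) (b : hom Q2 Q3),
      [/\ dist a b (comp (shiftm p1) d3),
          comp a p1 = comp p2 g /\ comp d2 a = d1
        & comp b p2 = p3 /\ comp d3 b = comp (shiftm f) d2] }.

Arguments shift {t} A.
Arguments shiftm {t A B} f.
Arguments dist {t A B C} f g h.

Definition is_cone (D : triangulated) (A B : D) (f : hom A B) (C : D) :=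
  exists (g : hom B C) (h : hom C (shift A)), dist f g h.

(* K(D): the free abelian group on the objects modulo the subgroup generated
    by [B] - [A] - [C] for A -> B -> C -> A[1] distinguished. *)

Section Kgroup.
Variable D : triangulated.

Definition freeK := {freeg {classic D}}.

Definition fcls (A : D) : freeK := << (A : {classic D}) >>.

Definition triangle_relation (x : freeK) :=
  exists (A B C : D) (f : hom A B) (g : hom B C) (h : hom C (shift A)),
    dist f g h /\ x = fcls B - fcls A - fcls C.

Definition Ksub : {pred freeK} := fun x =>
  `[< forall S : {pred freeK}, zmod_closed S ->
        (forall y, triangle_relation y -> y \in S) -> x \in S >].

Lemma Ksub_zmod_closed : zmod_closed Ksub.
Proof.
split=> [|x y /asboolP Kx /asboolP Ky].
  by apply/asboolP => S [S0 _] _.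
apply/asboolP => S cS relS; have [_ SB] := cS.
by apply: SB; [exact: Kx|exact: Ky].
Qed.

HB.instance Definition _ := GRing.isZmodClosed.Build freeK Ksub Ksub_zmod_closed.

Definition Kgroup : zmodType := Quotient.quot Ksub.

Definition Kcls (A : D) : Kgroup := (\pi_(Quotient.quot Ksub) (fcls A))%qT.

Lemma Kcls_dist (A B C : D) (f : hom A B) (g : hom B C) (h : hom C (shift A)) :
  dist f g h -> Kcls B = Kcls A + Kcls C.
Proof.
move=> fgh; transitivity (\pi_(Quotient.quot Ksub) (fcls A + fcls C))%qT.
  apply/eqP; rewrite -Quotient.idealrBE; apply/asboolP => S _; apply.
  by exists A, B, C, f, g, h; rewrite opprD addrA.
exact: Quotient.pi_add.
Qed.

End Kgroup.

Section Slicing.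
Variables (R : realType) (D : triangulated).

(* E_0 -> E_1 -> ... -> E_n = E with E_0 zero; the cone of E_j -> E_{j+1} is
   the factor of index j.  Only the data of index at most n are meaningful. *)
Record HN_filtration (P : R -> D -> Prop) (E : D) := HNFiltration {
  hn_len : nat;
  hn_obj : nat -> D;
  hn_map : forall j, hom (hn_obj j) (hn_obj j.+1);
  hn_factor : nat -> D;
  hn_phase : nat -> R;
  hn_start : is_zero (hn_obj 0);
  hn_end : hn_obj hn_len = E;
  hn_decr : forall j k, (j < k < hn_len)%N -> hn_phase k < hn_phase j;
  hn_cone : forall j, (j < hn_len)%N -> is_cone (hn_map j) (hn_factor j);
  hn_semi : forall j, (j < hn_len)%N -> P (hn_phase j) (hn_factor j) }.

(* Each P phi is a strictly full subcategory containing the zero objects, as is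
   implicit in calling it a full additive subcategory; closure under direct
   sums is a consequence of the other axioms.  Without this normalisation,
   distinct slicings could have the same semistable objects up to isomorphism,
   and so be at distance 0. *)
Record slicing := Slicing {
  slice :> R -> D -> Prop;
  slice_zero : forall phi E, is_zero E -> slice phi E;
  slice_iso : forall phi E F, isomorphic E F -> slice phi E -> slice phi F;
  slice_shift : forall phi E,
    slice (phi + 1) E <-> exists F, slice phi F /\ isomorphic E (shift F);
  slice_hom0 : forall phi1 phi2 E1 E2, phi2 < phi1 ->
    slice phi1 E1 -> slice phi2 E2 -> forall f : hom E1 E2, f = 0;
  slice_HN : forall E, inhabited (HN_filtration slice E) }.

Definition semistable (P : slicing) (phi : R) (E : D) :=
  P phi E /\ ~ is_zero E.

(* By uniqueness of HN filtrations, this does not depend on the choice of one;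
   for E nonzero it is finite and nonempty, so that its supremum and infimum
   are the largest and the smallest phase. *)
Definition phases (P : slicing) (E : D) : set R :=
  [set p | exists (F : HN_filtration P E) (j : nat),
     [/\ (j < hn_len F)%N, ~ is_zero (hn_factor F j) & hn_phase F j = p]].

Definition phi_plus (P : slicing) (E : D) : R := sup (phases P E).
Definition phi_minus (P : slicing) (E : D) : R := inf (phases P E).

(* 0 is added to the set because the supremum is taken in [0, +oo]: the
   ereal_sup of the empty set is -oo. *)
Definition slicing_dist (P Q : slicing) : \bar R :=
  ereal_sup [set x | x = 0%E \/ exists2 E : D, ~ is_zero E &
    x = `|phi_plus P E - phi_plus Q E|%:E \/
    x = `|phi_minus P E - phi_minus Q E|%:E].

Definition slicing_ball (P : slicing) (e : R) : set slicing :=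
  [set Q | (slicing_dist P Q < e%:E)%E].

Lemma slicing_ball_center P e : 0 < e -> slicing_ball P e P.
Proof.
move=> e0; rewrite /slicing_ball /=; apply: (@le_lt_trans _ _ 0%E).
  apply: ge_ereal_sup => x [->//|[E _ [] ->]]; by rewrite subrr normr0.
by rewrite lte_fin.
Qed.

Lemma slicing_ball_sym P Q e : slicing_ball P e Q -> slicing_ball Q e P.
Proof.
rewrite /slicing_ball /=; apply: le_lt_trans; apply: ge_ereal_sup => x Hx.
apply: ereal_sup_ubound; case: Hx => [->|[E nE H]]; first by left.
by right; exists E => //; case: H => ->; rewrite distrC; [left|right].
Qed.

Lemma slicing_ball_triangle P Q S e1 e2 :
  slicing_ball P e1 Q -> slicing_ball Q e2 S -> slicing_ball P (e1 + e2) S.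
Proof.
rewrite /slicing_ball /= => d1 d2.
have := lteD d1 d2; rewrite -EFinD; apply: le_lt_trans.
have le d x (A B : slicing) : slicing_dist A B = d ->
    (x = 0%E \/ exists2 E : D, ~ is_zero E &
    x = `|phi_plus A E - phi_plus B E|%:E \/
    x = `|phi_minus A E - phi_minus B E|%:E) -> (x <= d)%E.
  by move=> <- Hx; apply: ereal_sup_ubound.
apply: ge_ereal_sup => x [->|[E nE [] ->]].
- apply: adde_ge0; by apply: ereal_sup_ubound; left.
- apply: (@le_trans _ _ (`|phi_plus P E - phi_plus Q E|%:E +
                         `|phi_plus Q E - phi_plus S E|%:E)%E).
    by rewrite -EFinD lee_fin ler_distD.
  by apply: leeD; (apply: le; first by []); right; exists E => //; left.
- apply: (@le_trans _ _ (`|phi_minus P E - phi_minus Q E|%:E +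
                         `|phi_minus Q E - phi_minus S E|%:E)%E).
    by rewrite -EFinD lee_fin ler_distD.
  by apply: leeD; (apply: le; first by []); right; exists E => //; right.
Qed.

HB.instance Definition _ := gen_eqMixin slicing.
HB.instance Definition _ := gen_choiceMixin slicing.
HB.instance Definition _ :=
  hasNbhs.Build slicing (nbhs_ (entourage_ slicing_ball)).
HB.instance Definition _ := Nbhs_isPseudoMetric.Build R slicing
  erefl slicing_ball_center slicing_ball_sym slicing_ball_triangle erefl.

End Slicing.

(* Below, Lambda = Z^m (row vectors), Lambda_R = R^m and Hom(Lambda, C) = C^m
   (column vectors, acting by w |-> w *m Z). *)

HB.instance Definition _ (R : realType) :=
  PseudoMetric.copy R[i] (R[i] : numFieldType)^o.

Section QuadraticForm.
Variables (R : realType) (m : nat).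

Definition is_quadratic_form (Q : 'rV[R]_m -> R) :=
  (forall a x, Q (a *: x) = a ^+ 2 * Q x) /\
  (forall y, scalar (fun x => Q (x + y) - Q x - Q y)).

(* the R-linear extension of Z *)
Definition charge_lin (Z : 'cV[R[i]]_m) (x : 'rV[R]_m) : R[i] :=
  (map_mx (real_complex R) x *m Z) 0 0.

Definition latR (w : 'rV[int]_m) : 'rV[R]_m := map_mx intr w.

Definition neg_def_on_ker (Q : 'rV[R]_m -> R) (Z : 'cV[R[i]]_m) :=
  forall x, charge_lin Z x = 0 -> x != 0 -> Q x < 0.

End QuadraticForm.

Section Stability.
Variables (R : realType) (D : triangulated) (m : nat).
Variable v : {additive Kgroup D -> 'rV[int]_m}.

Definition charge (Z : 'cV[R[i]]_m) (E : D) : R[i] :=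
  (map_mx intr (v (Kcls E)) *m Z) 0 0.

(* The value is r * e^(i pi phi), written out with Euler's formula. *)
Definition prestability (Z : 'cV[R[i]]_m) (P : slicing R D) :=
  forall phi E, semistable P phi E ->
    exists2 r : R, 0 < r &
      charge Z E = (r * cos (pi * phi) +i* (r * sin (pi * phi)))%C.

Definition support_property (Q : 'rV[R]_m -> R)
    (Z : 'cV[R[i]]_m) (P : slicing R D) :=
  neg_def_on_ker Q Z /\
  (forall phi E, semistable P phi E -> 0 <= Q (latR R (v (Kcls E)))).

Record stab := Stab {
  stab_charge : 'cV[R[i]]_m;
  stab_slicing : slicing R D;
  stab_pre : prestability stab_charge stab_slicing;
  stab_support : exists Q,
    is_quadratic_form Q /\ support_property Q stab_charge stab_slicing }.

(* The initial topology of the pair of projections is the coarsest one making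
   both of them continuous. *)
HB.instance Definition _ := gen_eqMixin stab.
HB.instance Definition _ := gen_choiceMixin stab.
HB.instance Definition _ := Topological.copy stab
  (initial_topology (fun s : stab => (stab_charge s, stab_slicing s))).

End Stability.

Section Covering.
Variables (X Y : topologicalType).

Definition homeo_on (f : X -> Y) (S : set X) (V : set Y) :=
  [/\ set_bij S V f, {within S, continuous f}
    & exists g : Y -> X, [/\ {within V, continuous g}, {in V, cancel g f}
                             & {in S, cancel f g}]].

Definition evenly_covered (f : X -> Y) (U : set X) (V : set Y) :=
  exists sheets : set (set X),
    [/\ trivIset sheets id, \bigcup_(S in sheets) S = U `&` f @^-1` V
      & forall S, sheets S ->
          (exists2 O, open O & S = U `&` O) /\ homeo_on f S V].

(* The restriction of f to U is a covering of B; fibres may be empty. *)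
Definition covering_on (f : X -> Y) (U : set X) (B : set Y) :=
  [/\ {within U, continuous f}, f @` U `<=` B
    & forall y, B y ->
        exists2 O, open_nbhs y O & evenly_covered f U (B `&` O)].

End Covering.

(* Main.v *)
Require Import Defs.
From HB Require Import structures.
From mathcomp Require Import all_boot all_order all_algebra.
From mathcomp Require Import complex.
From mathcomp Require Import all_classical all_reals topology.
From mathcomp Require Import ereal normedtype trigo derive.
From mathcomp Require Import ring lra zify.
(* again, since the libraries shadow [hom] and [comp] *)
Import Defs.

(* Fix [sigma = (Z, P)] supported by [Q].  If only the real part of the central
   charge is changed, the hearts [P((k, k+1])] may be kept, and the new
   semistable objects of phase [phi] are the objects [E] of such a heart whose
   charge has phase [phi] and all of whose subobjects have charge of phase at
   most [phi].  The bound [c |x| <= |Z x|] on [{Q >= 0}] leaves only finitely many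
   classes of subobjects above the chord from [0] to the charge of [E], so that
   maximal destabilising subobjects exist and give Harder-Narasimhan filtrations.
   [Q >= 0] persists: while the charge moves linearly from [Z] to [Z'], merge two
   consecutive old HN factors of a new semistable object whenever their phases
   become equal; [Q] stays nonnegative on the sum since it is negative definite on
   the kernel of the intermediate charge, and in the end one class is left.
   Imaginary parts are changed in the same way on the hearts
   [P((k + 1/2, k + 3/2])].  All constants are uniform near a given charge, and two
   stability conditions with the same charge at distance less than [1] coincide;
   hence the set of all stability conditions supported by [Q] is open and is a
   covering. *)

Set Implicit Arguments.
Unset Strict Implicit.
Unset Printing Implicit Defensive.
Import Order.TTheory GRing.Theory Num.Theory.
Import numFieldNormedType.Exports.
Local Open Scope classical_set_scope.
Local Open Scope ring_scope.

(** * Triangulated categories *)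

(** The sign of the imaginary part alone separates a heart from its shift, so a change of the real
    part cannot disturb the hearts. Multiplication by [e^(- i pi / 2)] turns the imaginary part into
    a real part; two moves, through the mixed charge with one part from each end, therefore reach
    every nearby charge. Short exact sequences of a heart are encoded as triangles with three
    vertices in it, and kernels and images come from truncating a cone by Hom-vanishing. The lower
    bound on the charge must hold along each whole segment, since classes are merged at intermediate
    times. Closeness of charges is therefore measured by a box in real coordinates: it is convex and
    contains the mixed charge. The step size depends on the central charge only, neither on the
    slicing nor on the starting point in the box. Deforming away from the centre makes each sheet
    surject onto the base; deforming back to the centre shows that the sheets exhaust the preimage,
    also when the fibre is empty. *)

Section PreadditiveLemmas.
Variable D : preadditive.
Implicit Types A B C : D.

Lemma comp0m A B C (f : hom A B) : comp (0 : hom B C) f = 0.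
Proof. by apply: (@addrI _ (comp 0 f)); rewrite -compDl !addr0. Qed.

Lemma compm0 A B C (g : hom B C) : comp g (0 : hom A B) = 0.
Proof. by apply: (@addrI _ (comp g 0)); rewrite -compDr !addr0. Qed.

Lemma compNm A B C (g : hom B C) (f : hom A B) : comp (- g) f = - comp g f.
Proof. by apply/eqP; rewrite -addr_eq0 -compDl addNr comp0m. Qed.

Lemma compmN A B C (g : hom B C) (f : hom A B) : comp g (- f) = - comp g f.
Proof. by apply/eqP; rewrite -addr_eq0 -compDr addNr compm0. Qed.

Lemma zeroP A : is_zero A <-> idm A = 0.
Proof.
split=> [[+ _]|i0]; first exact.
by split=> B f; [rewrite -(comp1m f) i0 comp0m|rewrite -(compm1 f) i0 compm0].
Qed.

Lemma is_iso_id A : is_iso (idm A).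
Proof. by exists (idm A); rewrite !comp1m. Qed.

Lemma iso_refl A : isomorphic A A.
Proof. by exists (idm A); exact: is_iso_id. Qed.

Lemma iso_sym A B : isomorphic A B -> isomorphic B A.
Proof. by move=> [f [g [gf fg]]]; exists g, f. Qed.

Lemma iso_zero A B : isomorphic A B -> is_zero A -> is_zero B.
Proof.
move=> [f [g [gf fg]]] [zA _]; apply/zeroP.
by rewrite -fg (zA _ g) compm0.
Qed.

End PreadditiveLemmas.

Section TriangulatedLemmas.
Variable D : triangulated.
Implicit Types A B C E F T : D.

Lemma shiftm0 A B : shiftm (0 : hom A B) = 0.
Proof. by apply: (@addrI _ (shiftm 0)); rewrite -shiftmD !addr0. Qed.

Lemma shiftm_inj A B : injective (@shiftm D A B).
Proof. exact: bij_inj (shift_ff A B). Qed.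

Lemma shiftm_full A B (g : hom (shift A) (shift B)) : exists f, shiftm f = g.
Proof. by have [k _ kK] := shift_ff A B; exists (k g). Qed.

Lemma shift_zero A : is_zero (shift A) <-> is_zero A.
Proof.
split=> /zeroP H; apply/zeroP.
  by apply: shiftm_inj; rewrite shiftm1 shiftm0.
by rewrite -shiftm1 H shiftm0.
Qed.

Lemma shift_iso A B : isomorphic (shift A) (shift B) <-> isomorphic A B.
Proof.
split=> [[f [g [gf fg]]]|[f [g [gf fg]]]].
  have [f' ef] := shiftm_full f; have [g' eg] := shiftm_full g.
  exists f', g'; split; apply: shiftm_inj; rewrite shiftmM ef eg shiftm1 //.
by exists (shiftm f), (shiftm g); rewrite -!shiftmM gf fg !shiftm1.
Qed.

Lemma dist_rotr A B C (f : hom A B) (g : hom B C) h :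
  dist f g h -> dist g h (- shiftm f).
Proof. by move/dist_rot. Qed.

Lemma dist_comp0 A B C (f : hom A B) (g : hom B C) h :
  dist f g h -> comp g f = 0.
Proof.
have [Z zZ] := has_zero D.
move=> d; have [c [+ _]] := dist_mor (a := idm A) (b := f) (dist_id A zZ) d erefl.
by rewrite compm0.
Qed.

(** Exactness of [Hom(T, -)]: the pair [t], [0] extends to a morphism from the rotated trivial
    triangle on [T] to the rotated given one; its third component, unshifted, is the
    factorisation. *)
Lemma dist_exact2 A B C (f : hom A B) (g : hom B C) h T (t : hom T B) :
  dist f g h -> comp g t = 0 -> exists s, t = comp f s.
Proof.
have [Z zZ] := has_zero D.
move=> d gt; have d1 := dist_id T zZ.
have d2 : dist (0 : hom T Z) (0 : hom Z (shift T)) (- shiftm (idm T)).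
  exact: dist_rotr.
have d3 := dist_rotr d.
have [|c [_]] := dist_mor (a := t) (b := 0 : hom Z C) d2 d3.
  by rewrite comp0m gt.
have [s <-] := shiftm_full c.
rewrite shiftm1 compmN compm1 compNm -shiftmM => /oppr_inj/shiftm_inj ->.
by exists s.
Qed.

Lemma dist_exact2' A B C (f : hom A B) (g : hom B C) h T (t : hom B T) :
  dist f g h -> comp t f = 0 -> exists s, t = comp s g.
Proof.
have [Z zZ] := has_zero D.
move=> d tf.
have d2 : dist (0 : hom Z T) (idm T) (0 : hom T (shift Z)).
  apply/dist_rot; rewrite shiftm0 oppr0.
  by apply: dist_id; apply/shift_zero.
have [|c [+ _]] := dist_mor (a := 0 : hom A Z) (b := t) d d2.
  by rewrite comp0m tf.
by rewrite comp1m => <-; exists c.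
Qed.

(** The fibre of [g] is a desuspension of its cone. It exists only up to isomorphism, the shift
    being merely essentially surjective, hence the transport along [u]. *)
Lemma dist_rotl B C (g : hom B C) :
  exists A (f : hom A B) h, dist f g h.
Proof.
have [C' [h' [k d]]] := dist_ex g.
have [A [u [u' [u'u uu']]]] := shift_es C'.
have [f ef] := shiftm_full (- comp k u').
exists A, f, (comp u h'); apply/dist_rot.
apply: (dist_iso _ _ _ _ _ _ d).
- exact: is_iso_id.
- exact: is_iso_id.
- by exists u'; split; [exact: u'u|].
- by rewrite comp1m compm1.
- by rewrite compm1.
- by rewrite ef opprK shiftm1 comp1m -compA u'u compm1.
Qed.

Lemma dist_shift A B C (f : hom A B) (g : hom B C) h :
  dist f g h <-> dist (- shiftm f) (- shiftm g) (- shiftm h).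
Proof. by rewrite (dist_rot f) (dist_rot g) (dist_rot h). Qed.

(** Forgetting the maps lets triangles be rotated, shifted and replaced by isomorphic ones freely.
    When all vertices lie in a heart, this reads: [A] is a subobject of [B] with quotient [C]. *)
Definition tri A B C : Prop :=
  exists (f : hom A B) (g : hom B C) (h : hom C (shift A)), dist f g h.

Lemma tri_rot A B C : tri A B C -> tri B C (shift A).
Proof. by move=> [f [g [h /dist_rot d]]]; exists g, h, (- shiftm f). Qed.

Lemma tri_shift A B C : tri A B C <-> tri (shift A) (shift B) (shift C).
Proof.
split=> [[f [g [h /dist_shift d]]]|[f [g [h d]]]].
  by exists (- shiftm f), (- shiftm g), (- shiftm h).
have [f' ef] := shiftm_full (- f); have [g' eg] := shiftm_full (- g).
have [h' eh] := shiftm_full (- h).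
by exists f', g', h'; apply/dist_shift; rewrite ef eg eh !opprK.
Qed.

Lemma tri_rotl B C A : tri B C (shift A) -> tri A B C.
Proof.
move=> [g [h [k d]]].
have [f ef] := shiftm_full (- k).
by exists f, g, h; apply/dist_rot; rewrite ef opprK.
Qed.

Lemma tri_iso A B C A' B' C' :
  isomorphic A A' -> isomorphic B B' -> isomorphic C C' ->
  tri A B C -> tri A' B' C'.
Proof.
move=> [a [a' [a'a aa']]] [b [b' [b'b bb']]] [c [c' [c'c cc']]] [f [g [h d]]].
exists (comp b (comp f a')), (comp c (comp g b')), (comp (shiftm a) (comp h c')).
apply: (dist_iso (a := a) (b := b) (c := c) _ _ _ _ _ _ d);
  rewrite -?compA ?a'a ?b'b ?c'c ?compm1 //.
- by exists a'.
- by exists b'.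
- by exists c'.
Qed.

Lemma tri_id0 A Z : is_zero Z -> tri A A Z.
Proof. by move=> zZ; exists (idm A), 0, 0; exact: dist_id. Qed.

Lemma tri_0id A Z : is_zero Z -> tri Z A A.
Proof.
by move=> zZ; apply: tri_rotl; apply: tri_id0; apply/shift_zero.
Qed.

Lemma dist_zero3 A B C (f : hom A B) (g : hom B C) h :
  dist f g h -> is_zero C -> is_iso f.
Proof.
move=> d zC; have [s es] := dist_exact2 d (zC.1 _ (comp g (idm B))).
exists s; split=> //.
have d3 := dist_rotr (dist_rotr d).
have [|r er] := dist_exact2' (t := shiftm (idm A)) d3.
  by rewrite (zC.2 _ h) compm0.
have [r' er'] := shiftm_full (- r).
have e : comp r' f = idm A.
  by apply: shiftm_inj; rewrite shiftmM er' compNm -compmN er.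
by rewrite -[LHS]comp1m -e -compA (compA f) -es comp1m.
Qed.

Lemma tri_zero3 A B C : tri A B C -> is_zero C -> isomorphic A B.
Proof. by move=> [f [g [h d]]] zC; exists f; apply: dist_zero3 d zC. Qed.

Lemma tri_zero1 A B C : tri A B C -> is_zero A -> isomorphic B C.
Proof. by move=> /tri_rot t zA; apply: tri_zero3 t _; apply/shift_zero. Qed.

Lemma tri_comp_sub A B E X Y (f : hom A B) (g : hom B E) p d p' d' :
  @dist D A B X f p d -> @dist D B E Y g p' d' ->
  exists W (q : hom E W) k, dist (comp g f) q k /\ tri X W Y.
Proof.
move=> df dg; have [W [q [k dgf]]] := dist_ex (comp g f).
have [a [b [dab _ _]]] := dist_octa df dgf dg.
by exists W, q, k; split=> //; exists a, b, (comp (shiftm p) d').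
Qed.

(** Octahedral form of the third isomorphism theorem: [W] plays [E/A], with subobject [X = B/A] and
    quotient [Y = E/B]. *)
Lemma tri_sub_sub A B E X Y : tri A B X -> tri B E Y ->
  exists2 W, tri A E W & tri X W Y.
Proof.
move=> [f [p [d df]]] [g [p' [d' dg]]].
have [W [q [k [dW tW]]]] := tri_comp_sub df dg.
by exists W => //; exists (comp g f), q, k.
Qed.

(** [E'] is the preimage of [B'] in [E], built as the fibre of the composite to [C]. The map to [C]
    is recorded because [heart_image] must recognise when it is invertible. *)
Lemma tri_quot_map A E B B' C (f : hom A E) (g : hom E B) h
    (f' : hom B' B) (g' : hom B C) h' :
  dist f g h -> dist f' g' h' ->
  exists E' (i : hom E' E) k, dist i (comp g' g) k /\ tri A E' B'.
Proof.
move=> d d'.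
have d1 := dist_rotr d.
have d1' := dist_rotr d'.
have [E' [i [k dE]]] := dist_rotl (comp g' g).
have dE1 := dist_rotr dE.
have [a [b [dab _ _]]] := dist_octa d1 dE1 d1'.
exists E', i, k; split=> //; apply/tri_shift.
by exists a, b, (comp (shiftm h) (- shiftm f')).
Qed.

Lemma tri_quot A E B B' C : tri A E B -> tri B' B C ->
  exists2 E', tri E' E C & tri A E' B'.
Proof.
move=> [f [g [h d]]] [f' [g' [h' d']]].
have [E' [i [k [dE tE]]]] := tri_quot_map d d'.
by exists E' => //; exists i, (comp g' g), k.
Qed.

Definition hom0 A B := forall f : hom A B, f = 0.

Lemma hom0_isol A A' B : isomorphic A A' -> hom0 A B -> hom0 A' B.
Proof.
move=> [f [g [gf fg]]] H u.
by rewrite -(compm1 u) -fg compA (H (comp u f)) comp0m.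
Qed.

Lemma hom0_isor A B B' : isomorphic B B' -> hom0 A B -> hom0 A B'.
Proof.
move=> [f [g [gf fg]]] H u.
by rewrite -(comp1m u) -fg -compA (H (comp g u)) compm0.
Qed.

Lemma hom0_shift A B : hom0 (shift A) (shift B) <-> hom0 A B.
Proof.
split=> H f.
  by apply: shiftm_inj; rewrite shiftm0; exact: H.
by have [f' <-] := shiftm_full f; rewrite (H f') shiftm0.
Qed.

Lemma hom0_ext_r T A B C : tri A B C -> hom0 T A -> hom0 T C -> hom0 T B.
Proof.
move=> [f [g [h d]]] HA HC t.
have [s ->] := dist_exact2 d (HC (comp g t)).
by rewrite (HA s) compm0.
Qed.

Lemma hom0_ext_l T A B C : tri A B C -> hom0 A T -> hom0 C T -> hom0 B T.
Proof.
move=> [f [g [h d]]] HA HC t.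
have [s ->] := dist_exact2' d (HA (comp t f)).
by rewrite (HC s) comp0m.
Qed.

Lemma hom0_id A : hom0 A A -> is_zero A.
Proof. by move=> H; apply/zeroP/H. Qed.

Lemma hom0_zl A B : is_zero A -> hom0 A B.
Proof. by move=> [_ H] f; exact: H. Qed.

Lemma hom0_zr A B : is_zero B -> hom0 A B.
Proof. by move=> [H _] f; exact: H. Qed.

End TriangulatedLemmas.

(** * Slicings *)

Section HN.
Variables (R : realType) (D : triangulated).
Implicit Types (P : R -> D -> Prop) (A B C E F : D) (s : seq R).

(* The phases are listed from the bottom factor (smallest phase) upwards, and
   zero factors are discarded. *)
Inductive hn P : seq R -> D -> Prop :=
| hn_nil E : is_zero E -> hn P [::] E
| hn_cons s phi A E F : hn P s A -> tri A E F -> P phi F -> ~ is_zero F ->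
    all (fun x => phi < x) s -> hn P (phi :: s) E.

Lemma hn_iso P s E E' : isomorphic E E' -> hn P s E -> hn P s E'.
Proof.
move=> i h; case: h i => [{}E zE|{}s phi A {}E F hA t PF nF ls] i.
  by apply: hn_nil; exact: iso_zero zE.
apply: hn_cons hA _ PF nF ls.
by apply: tri_iso t => //; exact: iso_refl.
Qed.

Lemma hn1 P phi E : P phi E -> ~ is_zero E -> hn P [:: phi] E.
Proof.
have [Z zZ] := has_zero D.
move=> PE nE; apply: (hn_cons (s := [::]) (hn_nil _ zZ) _ PE nE) => //.
exact: tri_0id.
Qed.

(** The factors of [B] are peeled off from the bottom: each is also a quotient of [E], and what
    remains is the preimage of a smaller piece of [B], again an extension by [A]. *)
Lemma hn_cat P s t A E B : hn P t B -> hn P s A -> tri A E B ->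
  (forall x y, x \in t -> y \in s -> x < y) -> hn P (t ++ s) E.
Proof.
move=> hB; elim: hB A E => [{}B zB|{}t phi B' {}B F _ IH tB PF nF lt] A E hA tE lts.
  by apply: hn_iso hA; exact: tri_zero3 tE zB.
have [E' tE' tA] := tri_quot tE tB.
apply: (hn_cons (IH _ _ hA tA _) tE' PF nF).
  by move=> x y xt ys; apply: lts => //; rewrite inE xt orbT.
rewrite all_cat lt /=; apply/allP => y ys.
by apply: lts => //; rewrite inE eqxx.
Qed.

Lemma hn_of_filtration P (Piso : forall phi A B, isomorphic A B -> P phi A -> P phi B)
    E (H : HN_filtration P E) :
  exists2 s, hn P s E & forall p, p \in s <-> exists j : nat,
     [/\ (j < hn_len H)%N, ~ is_zero (hn_factor H j) & hn_phase H j = p].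
Proof.
suff main n : (n <= hn_len H)%N -> exists2 s, hn P s (hn_obj H n) &
    forall p, p \in s <-> exists j : nat,
     [/\ (j < n)%N, ~ is_zero (hn_factor H j) & hn_phase H j = p].
  have [s h1 h2] := main _ (leqnn _).
  by exists s => //; move: h1; rewrite (hn_end H).
elim: n => [_|n IH nl].
  exists [::]; first by apply: hn_nil; exact: hn_start.
  by move=> p; rewrite in_nil; split=> // -[j []].
have [s hs ps] := IH (ltnW nl).
have [g [h d]] := hn_cone nl.
have t : tri (hn_obj H n) (hn_obj H n.+1) (hn_factor H n) by exists (hn_map H n), g, h.
have [z|nz] := pselect (is_zero (hn_factor H n)).
  exists s; first by apply: hn_iso hs; exact: tri_zero3 t z.
  move=> p; rewrite ps; split=> -[j [jn nj pj]]; exists j; split=> //.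
    exact: leqW.
  move: jn; rewrite ltnS leq_eqVlt => /orP[/eqP jn|//].
  by case: nj; rewrite jn.
exists (hn_phase H n :: s).
  apply: hn_cons hs t (hn_semi nl) nz _.
  apply/allP => x /ps [j [jn _ <-]]; apply: hn_decr.
  by rewrite jn nl.
move=> p; rewrite inE; split.
  by case/orP=> [/eqP->|/ps[j [jn nj pj]]]; [exists n|exists j; split=> //; exact: leqW].
move=> [j [jn nj pj]]; move: jn; rewrite ltnS leq_eqVlt => /orP[/eqP jn|jn].
  by rewrite -pj jn eqxx.
by apply/orP; right; apply/ps; exists j.
Qed.

Lemma filtration_of_hn P s E : hn P s E ->
  exists H : HN_filtration P E, forall j, (j < hn_len H)%N -> hn_phase H j \in s.
Proof.
elim=> {s E} [E zE|s phi A E F _ [H Hs] t PF nF ls].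
  have dec j k : (j < k < 0)%N -> (0 : R) < 0 by rewrite ltn0 andbF.
  have con j : (j < 0)%N -> is_cone (idm E) E by [].
  have semi j : (j < 0)%N -> P 0 E by [].
  by exists (@HNFiltration _ _ P E 0 (fun=> E) (fun=> idm E) (fun=> E) (fun=> 0)
    zE erefl dec con semi).
pose n := hn_len H.
pose ob j := if (j <= n)%N then hn_obj H j else E.
pose fa j := if (j < n)%N then hn_factor H j else F.
pose ph j := if (j < n)%N then hn_phase H j else phi.
have ex j : exists f : hom (ob j) (ob j.+1), (j < n.+1)%N -> is_cone f (fa j).
  rewrite /ob /fa ltnS; case: (ltngtP j n) => jn.
  - by exists (hn_map H j) => _; exact: hn_cone.
  - by exists (idm E).
  - rewrite jn (hn_end H); have [f [g [h d]]] := t.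
    by exists f => _; exists g, h.
pose mp j := projT1 (cid (ex j)).
have mpP j : (j < n.+1)%N -> is_cone (mp j) (fa j) := projT2 (cid (ex j)).
have ob0 : is_zero (ob 0%N) by rewrite /ob /=; exact: hn_start.
have obn : ob n.+1 = E by rewrite /ob ltnn.
have dec j k : (j < k < n.+1)%N -> ph k < ph j.
  move=> /andP[jk]; rewrite ltnS leq_eqVlt => /orP[/eqP kn|kn].
    rewrite /ph kn ltnn -kn jk.
    by move/allP: ls; apply; apply: Hs; rewrite -/n -kn.
  by rewrite /ph kn (ltn_trans jk kn); apply: hn_decr; rewrite jk.
have semi j : (j < n.+1)%N -> P (ph j) (fa j).
  rewrite ltnS /ph /fa; case: (ltnP j n) => // jn _.
  exact: hn_semi.
exists (HNFiltration ob0 obn dec mpP semi) => /= j jn.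
rewrite /ph inE; case: ltnP => [jn'|_]; last by rewrite eqxx.
by rewrite Hs // orbT.
Qed.

End HN.

Section SlicingLemmas.
Variables (R : realType) (D : triangulated) (P : slicing R D).
Implicit Types (A B C E F : D) (s : seq R) (U V : R -> Prop).

(** For [U] closed upwards, [upper] and [lower] say that all HN phases lie in [U], respectively
    outside it. Stated by orthogonality, they pass to extensions and isomorphic objects at once, and
    one argument serves both strict and weak bounds. *)
Definition upper U E := forall psi F, P psi F -> ~ U psi -> hom0 E F.
Definition lower U E := forall psi F, P psi F -> U psi -> hom0 F E.
Definition up_closed U := forall x y, U x -> x < y -> U y.

Lemma hn_ex E : exists s, hn P s E.
Proof.
have [H] := slice_HN P E.
by have [s hs _] := hn_of_filtration (fun phi A B => @slice_iso _ _ P phi A B) H; exists s.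
Qed.

Lemma upper_iso U A B : isomorphic A B -> upper U A -> upper U B.
Proof. by move=> i H psi F PF nU; apply: hom0_isol i _; exact: H PF nU. Qed.

Lemma lower_iso U A B : isomorphic A B -> lower U A -> lower U B.
Proof. by move=> i H psi F PF nU; apply: hom0_isor i _; exact: H PF nU. Qed.

Lemma upper_zero U E : is_zero E -> upper U E.
Proof. by move=> z psi F _ _; exact: hom0_zl. Qed.

Lemma lower_zero U E : is_zero E -> lower U E.
Proof. by move=> z psi F _ _; exact: hom0_zr. Qed.

Lemma upper_ext U A B C : tri A B C -> upper U A -> upper U C -> upper U B.
Proof. by move=> t uA uC psi F PF nU; apply: hom0_ext_l t _ _; eauto. Qed.

Lemma lower_ext U A B C : tri A B C -> lower U A -> lower U C -> lower U B.
Proof. by move=> t uA uC psi F PF nU; apply: hom0_ext_r t _ _; eauto. Qed.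

Lemma upperW U V E : (forall x, U x -> V x) -> upper U E -> upper V E.
Proof. by move=> UV H psi F PF nV; apply: H PF _ => /UV. Qed.

Lemma lowerW U V E : (forall x, V x -> U x) -> lower U E -> lower V E.
Proof. by move=> UV H psi F PF nV; apply: H PF _; exact: UV. Qed.

Lemma slice_upper U phi E : up_closed U -> P phi E -> U phi -> upper U E.
Proof.
move=> Uup PE Up psi F PF nU; apply: slice_hom0 PE PF.
by rewrite ltNge; apply/negP; rewrite le_eqVlt => /orP[/eqP e|/(Uup _ _ Up)//]; rewrite e in Up.
Qed.

Lemma slice_lower U phi E : up_closed U -> P phi E -> ~ U phi -> lower U E.
Proof.
move=> Uup PE Up psi F PF nU; apply: slice_hom0 PF PE.
by rewrite ltNge; apply/negP; rewrite le_eqVlt => /orP[/eqP e|/(Uup _ _ nU)//]; rewrite e in nU.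
Qed.

Lemma hn_upper U s E : up_closed U -> hn P s E ->
  (forall x, x \in s -> U x) -> upper U E.
Proof.
move=> Uup; elim=> {s E} [E zE _|s phi A E F _ IH t PF _ _ Us]; first exact: upper_zero.
apply: upper_ext t _ _; first by apply: IH => x xs; apply: Us; rewrite inE xs orbT.
by apply: slice_upper PF _ => //; apply: Us; rewrite inE eqxx.
Qed.

Lemma hn_lower U s E : up_closed U -> hn P s E ->
  (forall x, x \in s -> ~ U x) -> lower U E.
Proof.
move=> Uup; elim=> {s E} [E zE _|s phi A E F _ IH t PF _ _ Us]; first exact: lower_zero.
apply: lower_ext t _ _; first by apply: IH => x xs; apply: Us; rewrite inE xs orbT.
by apply: slice_lower PF _ => //; apply: Us; rewrite inE eqxx.
Qed.

Lemma up_closed_gt a : up_closed (fun x => a < x).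
Proof. by move=> x y; exact: lt_trans. Qed.

Lemma up_closed_ge a : up_closed (fun x => a <= x).
Proof. by move=> x y ax /ltW; exact: le_trans. Qed.

Hint Resolve up_closed_gt up_closed_ge : core.

(** Only the lowest phase [phi] matters. Outside [U] it would give [Hom(E, F) = 0], while [Hom(A[1],
    F) = 0] because [F[-1]] has phase [phi - 1]; by the triangle [E -> F -> A[1]] the identity of
    [F] would vanish. *)
Lemma upper_hn U s E : up_closed U -> upper U E -> hn P s E ->
  forall x, x \in s -> U x.
Proof.
move=> Uup uE hE; case: hE uE => {s E} [E _ _ x //|s phi A E F hA t PF nF ls uE].
have Uphi : U phi.
  apply: contrapT => nU; apply: nF; apply: hom0_id.
  apply: hom0_ext_l (tri_rot t) (uE _ _ PF nU) _.
  have uA : upper (fun x => phi < x) A.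
    by apply: hn_upper hA _ => // x xs; move/allP: ls; apply.
  have [F' [PF' i]] : exists F', P (phi - 1) F' /\ isomorphic F (shift F').
    by apply/slice_shift; rewrite subrK.
  apply: hom0_isor (iso_sym i) _; apply/hom0_shift; apply: uA PF' _.
  by apply/negP; rewrite -leNgt; lra.
move=> x; rewrite inE => /orP[/eqP->//|xs].
by apply: Uup Uphi _; move/allP: ls; apply.
Qed.

Lemma hn_nonzero s E : hn P s E -> s != [::] -> ~ is_zero E.
Proof.
move=> h ns z; have zu : upper (fun=> False) E by exact: upper_zero.
case: s ns h => // x s _ /(upper_hn _ zu) H; apply: (H _ x) => //.
by rewrite inE eqxx.
Qed.

(** If the lowest phase is in [U], all are, and [E] is built from objects with no map to it, so it
    is zero. Otherwise [lower] descends to [A], which sits between [F[-1]] and [E], and the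
    induction applies. *)
Lemma lower_hn U s E : up_closed U -> lower U E -> hn P s E ->
  forall x, x \in s -> ~ U x.
Proof.
move=> Uup lE hE; elim: hE lE => {s E} [//|s phi A E F hA IH t PF nF ls lE].
have [Uphi|nU] := pselect (U phi).
  have hE : hn P (phi :: s) E by exact: hn_cons hA t PF nF ls.
  exfalso; apply: (hn_nonzero hE) => //; apply: hom0_id.
  have HF : hom0 F E by exact: lE PF Uphi.
  suff HA : hom0 A E by apply: hom0_ext_l t HA HF.
  have Us : all (fun x => `[< U x >]) s.
    by apply/allP => x /(allP ls) /(Uup _ _ Uphi)/asboolP.
  elim: hA Us {IH t ls hE} => {s A} [A zA _|s psi A B G _ IH t PG nG ls /= /andP[/asboolP U1 U2]].
    exact: hom0_zl.
  by apply: hom0_ext_l t _ _; [exact: IH|exact: lE PG U1].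
have lA : lower U A.
  move=> psi G PG Upsi; apply/hom0_shift.
  have tE := tri_rot (tri_rot t).
  apply: hom0_ext_r tE _ _; last by apply/hom0_shift; exact: lE PG Upsi.
  have PG1 : P (psi + 1) (shift G) by apply/slice_shift; exists G; split=> //; exact: iso_refl.
  apply: slice_hom0 PG1 PF.
  case: (ltP phi psi) => [h|]; first by lra.
  by rewrite le_eqVlt => /orP[/eqP e|/(Uup _ _ Upsi)//]; rewrite e in Upsi.
by move=> x; rewrite inE => /orP[/eqP->//|]; exact: IH.
Qed.

Lemma upper_lower_hom0 U A B : up_closed U -> upper U A -> lower U B -> hom0 A B.
Proof.
move=> Uup uA lB; have [s hs] := hn_ex A.
have Us := upper_hn Uup uA hs; clear uA.
elim: hs Us => {s A} [A zA _|s phi A' A F _ IH t PF nF _ Us]; first exact: hom0_zl.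
apply: hom0_ext_l t _ _.
  by apply: IH => x xs; apply: Us; rewrite inE xs orbT.
by apply: lB PF _; apply: Us; rewrite inE eqxx.
Qed.

Lemma upper_lower_zero U E : up_closed U -> upper U E -> lower U E -> is_zero E.
Proof. by move=> Uup uE lE; apply: hom0_id; apply: upper_lower_hom0 uE lE. Qed.

(** The t-structure attached to [U]: the HN factors with phase in [U] assemble to [A], the others to
    [B]. *)
Lemma truncation U E : up_closed U ->
  exists A B, [/\ upper U A, lower U B & tri A E B].
Proof.
move=> Uup; have [s hs] := hn_ex E; have [Z zZ] := has_zero D.
elim: hs => {s E} [E zE|s phi E' E F hE' [A [B [uA lB tA]]] t PF nF ls].
  exists E, E; split; [exact: upper_zero|exact: lower_zero|exact: tri_0id].
have [Uphi|nU] := pselect (U phi).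
  exists E, Z; split; [|exact: lower_zero|exact: tri_id0].
  apply: (hn_upper Uup (hn_cons hE' t PF nF ls)) => x.
  by rewrite inE => /orP[/eqP->//|/(allP ls)/(Uup _ _ Uphi)].
have [W tW tB] := tri_sub_sub tA t.
exists A, W; split=> //; apply: lower_ext tB lB _.
exact: slice_lower PF nU.
Qed.

Lemma slice_of_bounds phi E :
  upper (fun x => phi <= x) E -> lower (fun x => phi < x) E -> P phi E.
Proof.
move=> uE lE; have [s hs] := hn_ex E.
have U1 := upper_hn (@up_closed_ge phi) uE hs.
have L1 := lower_hn (@up_closed_gt phi) lE hs.
have all_s x : x \in s -> x = phi.
  move=> xs; apply/eqP; rewrite eq_le (U1 _ xs) andbT leNgt; apply/negP/(L1 _ xs).
clear uE lE; case: hs all_s {U1 L1} => [{}E zE _|{}s psi A {}E F hA t PF nF ls H]; first exact: slice_zero.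
rewrite -(H psi (mem_head _ _)).
apply: slice_iso PF; apply: iso_sym; apply: tri_zero1 t _.
case: hA ls H => // {A}{}s th B A G _ _ _ _ _ ls H.
have e1 : psi = phi by apply: H; rewrite inE eqxx.
have e2 : th = phi by apply: H; rewrite !inE eqxx orbT.
by move: ls; rewrite /= e1 e2 ltxx.
Qed.

Lemma slice_shiftE phi E : P (phi + 1) (shift E) <-> P phi E.
Proof.
split=> [/slice_shift[F [PF /shift_iso i]]|PE]; first by apply: slice_iso PF; exact: iso_sym.
by apply/slice_shift; exists E; split=> //; exact: iso_refl.
Qed.

Lemma slice_unshift phi E : P phi E -> exists2 F, P (phi - 1) F & isomorphic E (shift F).
Proof. by rewrite -{1}(subrK 1 phi) => /slice_shift[F [PF i]]; exists F. Qed.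

Lemma upper_shift U V E : (forall x, V (x + 1) <-> U x) -> upper V (shift E) <-> upper U E.
Proof.
move=> UV; split=> H psi F PF nU.
  by apply/hom0_shift; apply: (H (psi + 1)); [exact/slice_shiftE|rewrite UV].
have [G PG i] := slice_unshift PF; apply: hom0_isor (iso_sym i) _.
by apply/hom0_shift; apply: H PG _; rewrite -UV subrK.
Qed.

Lemma lower_shift U V E : (forall x, V (x + 1) <-> U x) -> lower V (shift E) <-> lower U E.
Proof.
move=> UV; split=> H psi F PF nU.
  by apply/hom0_shift; apply: (H (psi + 1)); [exact/slice_shiftE|rewrite UV].
have [G PG i] := slice_unshift PF; apply: hom0_isol (iso_sym i) _.
by apply/hom0_shift; apply: H PG _; rewrite -UV subrK.
Qed.

(** [A] lies between [B[-1]] and [E], and the phases of [B[-1]] are those of [B] lowered by [1].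
    This is how upper bounds pass to subobjects. *)
Lemma lower_sub U V A E B : tri A E B -> lower U E -> lower V B ->
  (forall x, U x -> V (x + 1)) -> lower U A.
Proof.
move=> t lE lB UV psi G PG Upsi; apply/hom0_shift.
apply: hom0_ext_r (tri_rot (tri_rot t)) _ _; last by apply/hom0_shift; exact: lE PG Upsi.
by apply: lB (UV _ Upsi); apply/slice_shiftE.
Qed.

Lemma upper_quot U V A E B : tri A E B -> upper U E -> upper V A ->
  (forall x, V (x - 1) -> U x) -> upper U B.
Proof.
move=> t uE uA VU psi F PF nU.
apply: hom0_ext_l (tri_rot t) _ _; first exact: uE PF nU.
have [G PG i] := slice_unshift PF; apply: hom0_isor (iso_sym i) _.
by apply/hom0_shift; apply: uA PG _ => /VU.
Qed.

Lemma bounds_ex E : exists M : R, 0 <= M /\ forall x, M <= x ->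
  upper (fun y => - x < y) E /\ lower (fun y => x < y) E.
Proof.
have [s hs] := hn_ex E.
have [M M0 Ms] : exists2 M : R, 0 <= M & forall x, x \in s -> `|x| < M.
  elim: s {hs} => [|y s [M M0 IH]]; first by exists 0.
  exists (M + `|y| + 1); first by have := normr_ge0 y; lra.
  move=> x; rewrite inE => /orP[/eqP->|/IH]; last by have := normr_ge0 y; lra.
  by lra.
exists M; split=> // x Mx; split.
  apply: hn_upper hs _ => // y /Ms; rewrite ltr_norml => /andP[]; lra.
apply: hn_lower hs _ => // y /Ms; rewrite ltr_norml => /andP[] ? ?.
by apply/negP; rewrite -leNgt; lra.
Qed.

Lemma phases_hn E : ~ is_zero E -> exists s, [/\ hn P s E, s != [::] &
   forall x, x \in s -> phases P E x].
Proof.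
move=> nE; have [H] := slice_HN P E.
have [s hs ps] := hn_of_filtration (fun phi A B => @slice_iso _ _ P phi A B) H.
exists s; split=> //; first by case: {ps} s hs => // hs; case: nE; inversion hs.
by move=> x /ps[j ?]; exists H, j.
Qed.

Lemma hn_phases E p : phases P E p -> exists2 s, hn P s E & p \in s.
Proof.
move=> [H [j Hj]].
have [s hs ps] := hn_of_filtration (fun phi A B => @slice_iso _ _ P phi A B) H.
by exists s => //; apply/ps; exists j.
Qed.

Lemma phi_plus_le b E : ~ is_zero E ->
  phi_plus P E <= b <-> lower (fun x => b < x) E.
Proof.
move=> nE; have [s [hs ns sp]] := phases_hn nE.
have lP c : lower (fun x => c < x) E -> ubound (phases P E) c.
  move=> lE p /hn_phases[t ht pt]; rewrite leNgt; apply/negP.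
  exact: lower_hn lE ht _ pt.
have ne : phases P E !=set0.
  by case: s ns sp {hs} => // x s _ /(_ x (mem_head _ _)); exists x.
split=> [h|/lP]; last exact: ge_sup.
apply: hn_lower hs _ => // x /sp px; apply/negP; rewrite -leNgt; apply: le_trans h.
apply: ub_le_sup => //; have [M [_ HM]] := bounds_ex E.
by exists M; apply: lP; exact: (HM M (lexx _)).2.
Qed.

Lemma phi_minus_ge a E : ~ is_zero E ->
  a <= phi_minus P E <-> upper (fun x => a <= x) E.
Proof.
move=> nE; have [s [hs ns sp]] := phases_hn nE.
have lP c : upper (fun x => c <= x) E -> lbound (phases P E) c.
  by move=> lE p /hn_phases[t ht pt]; exact: upper_hn lE ht _ pt.
have ne : phases P E !=set0.
  by case: s ns sp {hs} => // x s _ /(_ x (mem_head _ _)); exists x.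
split=> [h|/lP]; last exact: lb_le_inf.
apply: hn_upper hs _ => // x /sp px; apply: le_trans h _.
apply: ge_inf => //; have [M [_ HM]] := bounds_ex E.
exists (- M); apply: lP; apply: upperW (HM M (lexx _)).1 => x0; exact: ltW.
Qed.

End SlicingLemmas.

#[export] Hint Resolve up_closed_gt up_closed_ge : core.

Section SlicingDistance.
Variables (R : realType) (D : triangulated).
Implicit Types (P Q : slicing R D) (E : D).

Lemma slicing_dist_lt P Q e E : (slicing_dist P Q < e%:E)%E ->
  (forall b, lower P (fun x => b < x) E -> lower Q (fun x => b + e <= x) E) /\
  (forall a, upper P (fun x => a <= x) E -> upper Q (fun x => a - e < x) E).
Proof.
move=> d; have [z|nz] := pselect (is_zero E).
  by split=> *; [exact: lower_zero|exact: upper_zero].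
have le x : x = `|phi_plus P E - phi_plus Q E| \/ x = `|phi_minus P E - phi_minus Q E| -> x < e.
  move=> H; rewrite -lte_fin; apply: le_lt_trans d.
  by apply: ereal_sup_ubound; right; exists E => //; case: H => ->; [left|right].
have := le _ (or_introl erefl); have := le _ (or_intror erefl).
rewrite !ltr_norml => /andP[m1 m2] /andP[p1 p2]; split=> [b|a].
  move=> /(phi_plus_le _ _ nz) h.
  have : phi_plus Q E < b + e by lra.
  move/phi_plus_le: (lexx (phi_plus Q E)) => /(_ nz) lQ l.
  by apply: lowerW lQ => x /=; exact: lt_le_trans.
move=> /(phi_minus_ge _ _ nz) h.
have : a - e < phi_minus Q E by lra.
move/phi_minus_ge: (lexx (phi_minus Q E)) => /(_ nz) lQ l.
by apply: upperW lQ => x /=; exact: lt_le_trans.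
Qed.

(** Locating the [Q]-semistable objects in [P] is enough. Extensions bound the [P]-phases of any
    object by its [Q]-phases; the reverse bounds follow by orthogonality, testing against
    [Q]-semistable objects. *)
Lemma slicing_dist_le P Q e : 0 <= e ->
  (forall phi E, Q phi E -> lower P (fun x => phi + e < x) E /\
                            upper P (fun x => phi - e <= x) E) ->
  (slicing_dist P Q <= e%:E)%E.
Proof.
move=> e0 H; apply: ge_ereal_sup => y [->|[E nE HE]]; first by rewrite lee_fin.
have H1 b : lower Q (fun x => b < x) E -> lower P (fun x => b + e < x) E.
  move=> lE; have [s hs] := hn_ex Q E.
  have := lower_hn (@up_closed_gt _ b) lE hs; elim: hs => {s E nE HE lE y} [E zE _|s phi A E F _ IH t QF _ _ Hs].
    exact: lower_zero.
  apply: lower_ext t _ _; first by apply: IH => x xs; apply: Hs; rewrite inE xs orbT.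
  apply: lowerW (H _ _ QF).1 => x; have /negP := Hs _ (mem_head _ _); rewrite -leNgt; lra.
have H2 a : upper Q (fun x => a <= x) E -> upper P (fun x => a - e <= x) E.
  move=> lE; have [s hs] := hn_ex Q E.
  have := upper_hn (@up_closed_ge _ a) lE hs; elim: hs => {s E nE HE lE H1 y} [E zE _|s phi A E F _ IH t QF _ _ Hs].
    exact: upper_zero.
  apply: upper_ext t _ _; first by apply: IH => x xs; apply: Hs; rewrite inE xs orbT.
  apply: upperW (H _ _ QF).2 => x; have := Hs _ (mem_head _ _); lra.
have H3 b : lower P (fun x => b < x) E -> lower Q (fun x => b + e < x) E.
  move=> lE psi F QF bp; apply: upper_lower_hom0 (H _ _ QF).2 (lowerW _ lE) => //.
  by move=> x /=; lra.
have H4 a : upper P (fun x => a <= x) E -> upper Q (fun x => a - e <= x) E.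
  move=> lE psi F QF bp; apply: upper_lower_hom0 (upperW _ lE) (H _ _ QF).1 => //.
  by move=> x /=; move/negP: bp; rewrite -ltNge; lra.
have p1 := H1 _ ((phi_plus_le Q _ nE).1 (lexx _)); have p2 := H2 _ ((phi_minus_ge Q _ nE).1 (lexx _)).
have p3 := H3 _ ((phi_plus_le P _ nE).1 (lexx _)); have p4 := H4 _ ((phi_minus_ge P _ nE).1 (lexx _)).
move/phi_plus_le: p1 => /(_ nE) p1; move/phi_plus_le: p3 => /(_ nE) p3.
move/phi_minus_ge: p2 => /(_ nE) p2; move/phi_minus_ge: p4 => /(_ nE) p4.
by case: HE => ->; rewrite lee_fin ler_norml; lra.
Qed.

End SlicingDistance.

(** * Quadratic forms and linear functionals *)

Lemma seq_max (R : realDomainType) (T : eqType) (l : seq T) (p : T -> Prop) (f : T -> R) :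
  (exists x, x \in l /\ p x) ->
  exists x, [/\ x \in l, p x & forall y, y \in l -> p y -> f y <= f x].
Proof.
elim: l => [[x []//]|a l IH [x0 [x0l px0]]].
have [pa|npa] := pselect (p a); last first.
  have [|x [xl px xm]] := IH.
    by exists x0; move: x0l; rewrite inE => /orP[/eqP e|//]; rewrite e in px0.
  exists x; split=> // [|y]; first by rewrite inE xl orbT.
  by rewrite inE => /orP[/eqP->//|]; exact: xm.
have [ex|nex] := pselect (exists x, x \in l /\ p x); last first.
  exists a; split=> // [|y]; first exact: mem_head.
  by rewrite inE => /orP[/eqP->//|yl py]; case: nex; exists y.
have [x [xl px xm]] := IH ex; have [ax|xa] := leP (f a) (f x).
  exists x; split=> // [|y]; first by rewrite inE xl orbT.
  by rewrite inE => /orP[/eqP->//|]; exact: xm.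
exists a; split=> // [|y]; first exact: mem_head.
rewrite inE => /orP[/eqP->//|yl py].
by apply: le_trans (ltW xa); exact: xm.
Qed.

(** These are the crossing times of the merging argument. For [b = 0] the hypotheses force [a = 0],
    so every time is a root and [t0] is the earliest admissible one. *)
Lemma affine_root (R : realFieldType) (t0 a b : R) :
  t0 <= 1 -> 0 <= a + t0 * b -> a + b <= 0 ->
  let t := if b == 0 then t0 else - a / b in t0 <= t <= 1 /\ a + t * b = 0.
Proof.
move=> t1 h0 h1 /=; case: eqVneq => [b0|b0].
  move: h0 h1; rewrite b0 !mulr0 !addr0 lexx t1 => h0 h1; split=> //.
  by apply/eqP; rewrite eq_le h0 h1.
have [b1|b1] := ltP 0 b.
  have := ler_wpM2r (ltW b1) t1 => /= h.
  have -> : - a = b by lra.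
  rewrite divff // mul1r t1 lexx; split=> //; last by lra.
have bl : b < 0 by rewrite lt_neqAle b0 b1.
rewrite divfK //; split; last by ring.
rewrite ler_ndivlMr ?ler_ndivrMr //; lra.
Qed.

Lemma affine_ge0 (R : realFieldType) (t0 t1 t a b : R) : t0 <= t <= t1 ->
  0 <= a + t0 * b -> 0 <= a + t1 * b -> 0 <= a + t * b.
Proof.
move=> /andP[t0t tt1] h0 h1; have [b0|b0] := leP 0 b.
  have := ler_wpM2r b0 t0t => /= ?; lra.
have := ler_wnM2r (ltW b0) tt1 => /= ?; lra.
Qed.

Lemma sorted_merge (R : realFieldType) (T : Type) (f : T -> R) a u v w b :
  f u = f v -> f w = f u -> sorted (fun x y => f y <= f x) (a ++ u :: v :: b) ->
  sorted (fun x y => f y <= f x) (a ++ w :: b).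
Proof.
pose r := fun x y : R => y <= x.
have rtr : transitive r by move=> x y z h1 h2; exact: le_trans h2 h1.
have E M : sorted (fun x y => f y <= f x) M = sorted r (map f M) by rewrite sorted_map.
rewrite !E !map_cat /= => -> ->; apply: (subseq_sorted rtr).
apply: cat_subseq => //=; rewrite eqxx.
exact: subseq_cons.
Qed.

(** * Merging classes along a linear path of charges *)

Section Merge.
Variables (R : realFieldType) (V : zmodType) (X X' Y : V -> R) (Good : V -> Prop).
Hypotheses (XD : forall u v, X (u + v) = X u + X v)
           (XD' : forall u v, X' (u + v) = X' u + X' v)
           (YD : forall u v, Y (u + v) = Y u + Y v).

(* The cotangent of the phase of [u] with respect to [(1 - t) X + t X' + i Y]. *)
Let g t u := (X u + t * (X' u - X u)) / Y u.

Hypothesis merge : forall t u v, 0 <= t <= 1 -> Good u -> Good v ->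
  0 < Y u -> 0 < Y v -> g t u = g t v -> Good (u + v).

Variable c : R.

(** Lists begin with the bottom factor, so the suffix sums are the classes of the steps of the old
    HN filtration. With [c] the cotangent of the new phase, the inequalities are semistability
    tested on these subobjects. *)
Fixpoint psum (L : seq V) : Prop := if L is u :: L' then
    c * Y (\sum_(w <- L) w) <= X' (\sum_(w <- L) w) /\ psum L'
  else True.

Lemma psum_merge a u v b : psum (a ++ u :: v :: b) -> psum (a ++ (u + v) :: b).
Proof.
elim: a => [|w a IH] /=; first by rewrite !big_cons addrA => -[? [_ ?]].
rewrite !big_cons !big_cat /= !big_cons !addrA => -[h /IH ?]; split=> //.
Qed.

Lemma sum_lt u L : L != [::] -> (forall w, w \in L -> 0 < Y w) ->
  (forall w, w \in L -> X' w < u * Y w) -> X' (\sum_(w <- L) w) < u * Y (\sum_(w <- L) w).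
Proof.
have X0 : X' 0 = 0 by have := XD' 0 0; rewrite addr0; lra.
have Y0 : Y 0 = 0 by have := YD 0 0; rewrite addr0; lra.
elim: L => // a L IH _ Y1 X1; rewrite !big_cons XD' YD mulrDr.
have := X1 _ (mem_head _ _); case: L IH Y1 X1 => [|b L] IH Y1 X1.
  by rewrite big_nil X0 Y0; lra.
have : X' (\sum_(w <- b :: L) w) < u * Y (\sum_(w <- b :: L) w).
  by apply: IH => // w wL; [apply: Y1|apply: X1]; rewrite inE wL orbT.
lra.
Qed.

(* Induction on the length of [L]: at the first time after [t0] at which two
   consecutive phases agree, the pair is replaced by its sum. *)
Lemma Good_sum L t0 : 0 <= t0 <= 1 -> L != [::] ->
  (forall u, u \in L -> Good u /\ 0 < Y u) ->
  sorted (fun u v => g t0 v <= g t0 u) L -> psum L ->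
  c * Y (\sum_(w <- L) w) = X' (\sum_(w <- L) w) -> Good (\sum_(w <- L) w).
Proof.
have [n] := ubnP (size L); elim: n => // n IH in L t0 *.
rewrite ltnS => Ln t01 L0 LG Ls Lp Lc.
pose d i t := g t (nth 0 L i) - g t (nth 0 L i.+1).
have dE i t : d i t = d i 0 + t * (d i 1 - d i 0) by rewrite /d /g; ring.
have LGi i : (i < size L)%N -> Good (nth 0 L i) /\ 0 < Y (nth 0 L i).
  by move=> iL; apply: LG; exact: mem_nth.
have d0 i : (i.+1 < size L)%N -> 0 <= d i t0.
  by move=> iL; rewrite subr_ge0; move/(sortedP 0): Ls; exact.
have [cr|ncr] := pselect (exists i, i \in iota 0 (size L).-1 /\ d i 1 <= 0); last first.
  have d1 i : (i.+1 < size L)%N -> 0 < d i 1.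
    move=> iL; rewrite ltNge; apply/negP => di; apply: ncr; exists i.
    by rewrite mem_iota add0n; split=> //; lia.
  case: L L0 Lc Lp LG {Ln LGi Ls d0 ncr dE} @d d1 => // u L _ Lc Lp LG d d1.
  have [L0|L0] := eqVneq L [::].
    by rewrite L0 big_cons big_nil addr0; apply: (LG _ _).1; exact: mem_head.
  (* No pair meets by time [1], so [u] then has the strictly largest slope and the tail [S] a
     smaller one. But [psum] gives [S] slope at least [c], and the total slope is [c], so [u] has
     slope at most [c]: contradiction. *)
  exfalso.
  have lt w : w \in L -> g 1 w < g 1 u.
    have : sorted (fun u v => g 1 v < g 1 u) (u :: L).
      by apply/(sortedP 0) => i iL; rewrite -subr_gt0; exact: d1.
    rewrite /= path_sortedE; last by move=> x y z h1 h2; exact: lt_trans h2 h1.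
    by move=> /andP[/allP + _]; exact.
  have YL w : w \in u :: L -> 0 < Y w by move/LG => [].
  have Yu := YL _ (mem_head _ _).
  have YL' w : w \in L -> 0 < Y w by move=> wL; apply: YL; rewrite inE wL orbT.
  have := @sum_lt (X' u / Y u) L L0 YL'.
  have H w : w \in L -> X' w < X' u / Y u * Y w.
    move=> wL; have := lt _ wL; rewrite /g !mul1r !(addrC (X _)) !subrK => h.
    by rewrite -ltr_pdivrMr // YL'.
  move=> /(_ H) h.
  set S := \sum_(w <- L) w in h.
  have h1 : c * Y S <= X' S.
    by rewrite /S; have [_ +] := Lp; case: (L) L0 => // v M _ [].
  have Lc' : c * (Y u + Y S) = X' u + X' S by move: Lc; rewrite big_cons -/S XD' YD.
  have YS : 0 < Y S.
    rewrite /S; have Y0 : Y 0 = 0 by have := YD 0 0; rewrite addr0; lra.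
    move: L0 YL'; elim: (L) => // a M IHM _ YM; rewrite big_cons YD.
    have := YM _ (mem_head _ _); case: M IHM YM => [|b M] IHM YM.
      by rewrite big_nil Y0 addr0.
    move=> Ya; apply: addr_gt0 => //; apply: IHM => // w wM.
    by apply: YM; rewrite inE wM orbT.
  have : X' u <= c * Y u by lra.
  rewrite -ler_pdivrMr // => h2.
  by have : X' u / Y u * Y S <= c * Y S by [rewrite ler_pM2r]; lra.
pose b i := d i 1 - d i 0.
pose T i := if b i == 0 then t0 else - d i 0 / b i.
have bE j t : d j t = d j 0 + t * b j by exact: dE.
have b1 j : d j 1 = d j 0 + b j by rewrite (bE j 1) mul1r.
(* Maximising [- T] selects the earliest crossing; up to that time every difference [d j] stays
   nonnegative, so the list is still sorted there. *)
have [i [iL di im]] := seq_max (fun i => - T i) cr.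
have TP j : (j.+1 < size L)%N -> d j 1 <= 0 -> t0 <= T j <= 1 /\ d j (T j) = 0.
  move=> /d0; rewrite (bE j t0) b1 (bE j (T j)) => h0 h1.
  by case/andP: t01 => _ t1; exact: affine_root t1 h0 h1.
have iL1 : (i.+1 < size L)%N.
  by move: iL; rewrite mem_iota add0n /=; case: (size L).
have [Ti dT] := TP _ iL1 di.
have T01 : 0 <= T i <= 1.
  by case/andP: t01 => t01 _; case/andP: Ti => /(le_trans t01) -> ->.
have dTj j : (j.+1 < size L)%N -> 0 <= d j (T i).
  move=> jL; have := d0 _ jL.
  have [dj1|dj1] := ltP 0 (d j 1).
    move: (ltW dj1); rewrite (bE j 1) (bE j t0) (bE j (T i)) => h1 h0.
    exact: affine_ge0 Ti h0 h1.
  have [Tj dTj] := TP _ jL dj1.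
  have TT : T i <= T j.
    by rewrite -lerN2; apply: im => //; rewrite mem_iota add0n leq0n /=; case: (size L) jL.
  move: (lexx (0 : R)); rewrite -{2}dTj (bE j (T j)) (bE j t0) (bE j (T i)) => h1 h0.
  by apply: affine_ge0 h0 h1; case/andP: Ti => -> _.
set u := nth 0 L i; set v := nth 0 L i.+1.
have LE : L = take i L ++ u :: v :: drop i.+2 L.
  by rewrite -!drop_nth ?cat_take_drop // ltnW.
have guv : g (T i) u = g (T i) v by apply/eqP; rewrite -subr_eq0 -/(d i (T i)) dT.
have [Gu Yu] := LGi _ (ltnW iL1); have [Gv Yv] := LGi _ iL1.
have guv' : g (T i) (u + v) = g (T i) u.
  have : g (T i) u * Y u = X u + T i * (X' u - X u) by rewrite /g divfK // gt_eqF.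
  have : g (T i) u * Y v = X v + T i * (X' v - X v) by rewrite guv /g divfK // gt_eqF.
  rewrite /g XD XD' YD => e1 e2.
  by apply: (@mulIf _ (Y u + Y v)); [lra|rewrite divfK; lra].
pose L' := take i L ++ (u + v) :: drop i.+2 L.
have SE : \sum_(w <- L) w = \sum_(w <- L') w.
  by rewrite {1}LE /L' !big_cat /= !big_cons !addrA.
rewrite SE; apply: (IH L' (T i)) => //.
- have : size L = (size L').+1 by rewrite {1}LE /L' !size_cat /= !addnS.
  by lia.
- by rewrite /L'; case: (take i L).
- move=> w; rewrite mem_cat inE => /or3P[wt|/eqP->|wd].
  + by apply: LG; exact: mem_take wt.
  + by split; [exact: merge Gu Gv Yu Yv guv|rewrite YD; lra].
  + by apply: LG; exact: mem_drop wd.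
- have : sorted (fun x y => g (T i) y <= g (T i) x) L.
    by apply/(sortedP 0) => j jL; rewrite -subr_ge0; exact: dTj.
  by rewrite {1}LE; apply: sorted_merge.
- by apply: psum_merge; rewrite -LE.
- by rewrite -SE.
Qed.

End Merge.

(** * Real functionals on [R^m], quadratic forms and the support inequality *)

Section Functionals.
Variables (R : realType) (m : nat).
Implicit Types (p q : 'cV[R]_m) (x y : 'rV[R]_m).

Definition ev p x : R := (x *m p) 0 0.

Lemma evD p x y : ev p (x + y) = ev p x + ev p y.
Proof. by rewrite /ev mulmxDl mxE. Qed.

Lemma evZ p a x : ev p (a *: x) = a * ev p x.
Proof. by rewrite /ev -scalemxAl mxE. Qed.

Lemma evN p x : ev p (- x) = - ev p x.
Proof. by rewrite -scaleN1r evZ mulN1r. Qed.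

Lemma ev0 p : ev p 0 = 0.
Proof. by rewrite -(scale0r 0) evZ mul0r. Qed.

Lemma ev_addl p q x : ev (p + q) x = ev p x + ev q x.
Proof. by rewrite /ev mulmxDr mxE. Qed.

Lemma ev_scalel a p x : ev (a *: p) x = a * ev p x.
Proof. by rewrite /ev -scalemxAr mxE. Qed.

Lemma ev_oppl p x : ev (- p) x = - ev p x.
Proof. by rewrite -scaleN1r ev_scalel mulN1r. Qed.

Definition l1norm x : R := \sum_i `|x 0 i|.

Lemma l1norm_ge0 x : 0 <= l1norm x.
Proof. by apply: sumr_ge0 => i _. Qed.

Lemma l1norm_coord x i : `|x 0 i| <= l1norm x.
Proof. by rewrite /l1norm (bigD1 i) //= lerDl sumr_ge0. Qed.

Lemma l1norm_eq0 x : l1norm x <= 0 -> x = 0.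
Proof.
move=> h; apply/rowP => i; rewrite mxE; apply/eqP; rewrite -normr_le0.
exact: le_trans (l1norm_coord x i) h.
Qed.

Lemma l1normD x y : l1norm (x + y) <= l1norm x + l1norm y.
Proof.
rewrite /l1norm -big_split /=; apply: ler_sum => i _.
by rewrite mxE ler_normD.
Qed.

Lemma l1normZ a x : l1norm (a *: x) = `|a| * l1norm x.
Proof. by rewrite /l1norm mulr_sumr; apply: eq_bigr => i _; rewrite mxE normrM. Qed.

Lemma ev_bound p d x : (forall i, `|p i 0| <= d) -> `|ev p x| <= d * l1norm x.
Proof.
move=> pd; rewrite /ev mxE /l1norm mulr_sumr; apply: le_trans (ler_norm_sum _ _ _) _.
apply: ler_sum => i _; rewrite normrM mulrC; exact: ler_wpM2r.
Qed.

Lemma lattice_finite (M : R) :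
  exists l : seq 'rV[int]_m, forall w, l1norm (latR R w) <= M -> w \in l.
Proof.
have [K MK] : exists K : nat, M < K%:R.
  by exists (Num.truncn `|M|).+1; apply: le_lt_trans (ler_norm M) _; exact: truncnS_gt.
exists [seq \row_i ((nat_of_ord (f i))%:Z - K%:Z) | f : {ffun 'I_m -> 'I_(K + K).+1}] => w wM.
have wK i : (`|w 0 i| <= K%:Z).
  rewrite -(ler_int R) intr_norm; apply: ltW; apply: le_lt_trans MK.
  by apply: le_trans wM; have := l1norm_coord (latR R w) i; rewrite mxE.
apply/fintype.imageP; exists [ffun i => inord (absz (w 0 i + K%:Z)%R)] => //.
apply/rowP => i; rewrite mxE ffunE.
move: (wK i); move: (w 0 i) => z zK; rewrite inordK; move: zK; rewrite ler_norml; lia.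
Qed.

Section Quad.
Variable Q : 'rV[R]_m -> R.
Hypothesis hQ : is_quadratic_form Q.

Let B x y := Q (x + y) - Q x - Q y.

Lemma quadZ a x : Q (a *: x) = a ^+ 2 * Q x. Proof. exact: hQ.1. Qed.

Lemma quad0 : Q 0 = 0.
Proof. by rewrite -(scale0r 0) quadZ expr0n mul0r. Qed.

Let BZ a x y : B (a *: x) y = a * B x y.
Proof.
have h := hQ.2 y a x 0; rewrite !addr0 /= add0r quad0 in h.
by rewrite /B h; ring.
Qed.

Let BC x y : B x y = B y x.
Proof. by rewrite /B (addrC y); ring. Qed.

Let BD x x' y : B (x + x') y = B x y + B x' y.
Proof. by have /= := hQ.2 y 1 x x'; rewrite scale1r mul1r. Qed.

(** With [a = ev q y] and [b = ev q x], the vector [a x - b y] is killed by [p] and [q]. Expanding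
    [Q (a x - b y) <= 0] gives [a b B(x, y) >= a^2 Q x + b^2 Q y >= 0], so the polar form is
    nonnegative on [x], [y]. *)
Lemma quad_merge p q x y : (forall z, ev p z = 0 -> ev q z = 0 -> Q z <= 0) ->
  0 <= Q x -> 0 <= Q y -> 0 < ev q x -> 0 < ev q y ->
  ev p x * ev q y = ev p y * ev q x -> 0 <= Q (x + y).
Proof.
move=> neg Qx Qy qx qy e.
set a := ev q y in qy e *; set b := ev q x in qx e *.
have : Q (a *: x + (- b) *: y) <= 0.
  apply: neg; rewrite evD !evZ; first by rewrite -/a -/b; lra.
  by rewrite -/a -/b; ring.
have -> : Q (a *: x + (- b) *: y) = B (a *: x) ((- b) *: y) + Q (a *: x) + Q ((- b) *: y).
  by rewrite /B; ring.
have -> : Q (x + y) = B x y + Q x + Q y by rewrite /B; ring.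
rewrite BZ (BC x) BZ (BC y) !quadZ.
move: (B x y) => t h.
have h1 : 0 <= a ^+ 2 * Q x by rewrite mulr_ge0 // exprn_ge0 // ltW.
have h2 : 0 <= b ^+ 2 * Q y by rewrite mulr_ge0 // exprn_ge0 // ltW.
have ab : 0 < a * b by exact: mulr_gt0.
have : 0 <= a * b * t by move: h; rewrite sqrrN; lra.
by rewrite pmulr_rge0 //; lra.
Qed.

Let Bsum (I : finType) (F : I -> 'rV[R]_m) y : B (\sum_i F i) y = \sum_i B (F i) y.
Proof.
apply: (big_morph (fun x => B x y)) => [u v|]; first exact: BD.
by rewrite -(scale0r 0) BZ mul0r.
Qed.

Lemma quad_continuous : continuous Q.
Proof.
have QE x : Q x = \sum_i \sum_j x 0 i * (x 0 j * (B (delta_mx 0 i) (delta_mx 0 j) / 2)).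
  have -> : Q x = B x x / 2.
    have e : x + x = 2 *: x by rewrite scaler_nat mulr2n.
    by rewrite /B e quadZ; field.
  rewrite {1}[x in B x](row_sum_delta x) Bsum mulr_suml; apply: eq_bigr => i _.
  rewrite BZ BC [in B x](row_sum_delta x) Bsum mulr_sumr mulr_suml; apply: eq_bigr => j _.
  by rewrite BZ BC; ring.
rewrite (_ : Q = fun x => \sum_i \sum_j x 0 i * (x 0 j * (B (delta_mx 0 i) (delta_mx 0 j) / 2))); last exact/funext.
apply: continuous_big => [|i _]; first exact: add_continuous.
apply: continuous_big => [|j _]; first exact: add_continuous.
move=> x; apply: cvgM; [exact: (@nbhs_filter _ x)|exact: coord_continuous|].
by apply: cvgM; [exact: (@nbhs_filter _ x)|exact: coord_continuous|exact: cst_continuous].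
Qed.

Lemma ev_continuous p : continuous (ev p).
Proof.
rewrite (_ : ev p = fun x => \sum_j x 0 j * p j 0); last first.
  by apply/funext => x; rewrite /ev mxE.
apply: continuous_big => [|i _]; first exact: add_continuous.
by move=> x; apply: cvgM; [exact: (@nbhs_filter _ x)|exact: coord_continuous|exact: cst_continuous].
Qed.

Lemma l1norm_continuous : continuous l1norm.
Proof.
apply: continuous_big => [|i _]; first exact: add_continuous.
by move=> x; apply: cvg_norm; [exact: (@nbhs_filter _ x)|exact: coord_continuous].
Qed.

(** Compactness: [c] is the minimum of [|p| + |q|] on the part of the [l1] unit sphere where
    [Q >= 0]; negativity of [Q] on the common kernel makes it positive, and homogeneity does the
    rest. *)
Lemma support_constant p q : (forall z, ev p z = 0 -> ev q z = 0 -> z != 0 -> Q z < 0) ->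
  exists2 c, 0 < c & forall x, 0 <= Q x -> c * l1norm x <= `|ev p x| + `|ev q x|.
Proof.
move=> neg.
pose K := [set x : 'rV[R]_m | (forall i, `[(-1 : R), 1]%classic (x ord0 i))] `&`
  (l1norm @^-1` [set 1] `&` Q @^-1` [set t | 0 <= t]).
have cK : compact K.
  apply: compact_closedI.
    by apply: (@rV_compact R m (fun=> `[(-1 : R), 1]%classic)) => i; exact: segment_compact.
  apply: closedI.
    by apply: closed_comp => [x _|]; [exact: l1norm_continuous|exact: closed_eq].
  by apply: closed_comp => [x _|]; [exact: quad_continuous|exact: closed_ge].
have K1 x : 0 <= Q x -> x != 0 -> K ((l1norm x)^-1 *: x).
  move=> Qx x0; have Nx : 0 < l1norm x.
    by rewrite lt_neqAle l1norm_ge0 andbT eq_sym; apply: contra x0 => /eqP e; rewrite [x]l1norm_eq0 ?e.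
  have n1 : l1norm ((l1norm x)^-1 *: x) = 1.
    by rewrite l1normZ gtr0_norm ?invr_gt0 // mulVf // gt_eqF.
  split; last by split=> //=; rewrite quadZ mulr_ge0 // exprn_ge0 // invr_ge0 ltW.
  by move=> i; rewrite /= in_itv /= -ler_norml -n1 l1norm_coord.
(* [K] may be empty; then [0] is the only vector with [Q >= 0], and any constant works. *)
have [K0|K0] := pselect (K !=set0); last first.
  exists 1 => // x Qx; have [->|x0] := eqVneq x 0.
    by rewrite -(scale0r 0) l1normZ normr0 mul0r mulr0 addr_ge0.
  by case: K0; exists ((l1norm x)^-1 *: x); exact: K1.
have [|x0 + x0m] := @compact_EVT_min _ R (fun x => `|ev p x| + `|ev q x|) K K0 cK.
  have cn r : continuous (fun x => `|ev r x|).
    by move=> x; apply: cvg_norm; [exact: (@nbhs_filter _ x)|exact: ev_continuous].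
  apply: continuous_subspaceT => x.
  by apply: cvgD; [exact: (@nbhs_filter _ x)|exact: cn|exact: cn].
rewrite inE => -[_ [n1 /= Qx0]].
exists (`|ev p x0| + `|ev q x0|).
  rewrite lt_neqAle addr_ge0 // andbT; apply/negP => /eqP/esym e.
  have p0 : ev p x0 = 0.
    apply/eqP; rewrite -normr_le0; rewrite -e lerDl //.
  have q0 : ev q x0 = 0.
    apply/eqP; rewrite -normr_le0; rewrite -e lerDr //.
  have x00 : x0 != 0.
    apply/eqP => e0; move: n1; rewrite /= e0 -(scale0r 0) l1normZ normr0 mul0r.
    by move/eqP; rewrite eq_sym oner_eq0.
  by have := neg _ p0 q0 x00; rewrite ltNge Qx0.
move=> x Qx; have [->|xn0] := eqVneq x 0.
  by rewrite -{1}(scale0r 0) l1normZ normr0 mul0r mulr0 addr_ge0.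
have Nx : 0 < l1norm x.
  by rewrite lt_neqAle l1norm_ge0 andbT eq_sym; apply: contra xn0 => /eqP e; rewrite [x]l1norm_eq0 ?e.
have := x0m _ (mem_set (K1 _ Qx xn0)).
rewrite !evZ !normrM gtr0_norm ?invr_gt0 // -mulrDr mulrC -ler_pdivlMr ?invr_gt0 //.
Qed.

End Quad.
End Functionals.

(** * Phases and angles *)

Section Angles.
Variable R : realType.
Implicit Types (a b d e eta r u x y : R).

Lemma sinpi_gt0 d : 0 < d < 1 -> 0 < sin (pi * d).
Proof.
move=> /andP[d0 d1]; apply: sin_gt0_pi; rewrite mulr_gt0 ?pi_gt0 //=.
by rewrite -{2}(mulr1 pi) ltr_pM2l ?pi_gt0.
Qed.

Lemma sinpi_ge0 d : 0 <= d <= 1 -> 0 <= sin (pi * d).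
Proof.
move=> /andP[d0 d1]; apply: sin_ge0_pi; rewrite mulr_ge0 ?pi_ge0 //=.
by rewrite -{2}(mulr1 pi) ler_pM2l ?pi_gt0.
Qed.

Lemma sinpi_homo d e : 0 <= d -> d <= e -> e <= 2^-1 -> sin (pi * d) <= sin (pi * e).
Proof.
move=> d0; rewrite le_eqVlt => /orP[/eqP->//|de e2]; apply: ltW.
have p0 := pi_gt0 R.
have H t : 0 <= t <= 2^-1 -> (pi * t : R) \in `[(- (pi/2)), (pi/2)].
  move=> /andP[t0 t1]; rewrite in_itv /=; apply/andP; split.
    by apply: (@le_trans _ _ 0); [rewrite oppr_le0 divr_ge0 // ltW|rewrite mulr_ge0 // ltW].
  by rewrite ler_pM2l.
rewrite ltr_sin ?ltr_pM2l // H //; apply/andP; split; lra.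
Qed.

Lemma sinpi_compl d : sin (pi * (1 - d)) = sin (pi * d).
Proof. by rewrite mulrBr mulr1 sinB sinpi cospi; ring. Qed.

Lemma sinpi_lower e d : 0 <= e -> e <= d -> d <= 1 - e -> sin (pi * e) <= sin (pi * d).
Proof.
move=> e0 ed de; have [h|h] := leP d 2^-1; first exact: sinpi_homo.
by rewrite -(sinpi_compl d); apply: sinpi_homo; lra.
Qed.

(* Both bounds compare [sin] of the difference [d] of two phases in [(0,1]]
   with [sin] of one of them: if [d] is not itself close to [1], it is bounded
   below by [sin (pi e)]; otherwise [a] is squeezed towards an end point. *)
Lemma angle_upper e eta a b : 0 < e <= 2^-1 -> 0 <= eta -> eta < sin (pi * e) ->
  0 < a -> b <= 1 -> a + e < b -> eta * sin (pi * a) < sin (pi * (b - a)).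
Proof.
move=> /andP[e0 e2] eta0 eta1 a0 b1 ab.
have sa : 0 <= sin (pi * a) by apply: sinpi_ge0; lra.
have sd : 0 < sin (pi * (b - a)) by apply: sinpi_gt0; lra.
have [h|h] := leP (b - a) (1 - e).
  apply: (@le_lt_trans _ _ eta); first by rewrite ler_piMr // sin_le1.
  by apply: lt_le_trans eta1 _; apply: sinpi_lower; lra.
apply: (@le_lt_trans _ _ (eta * sin (pi * (b - a)))).
  by rewrite ler_wpM2l // -(sinpi_compl (b - a)); apply: sinpi_homo; lra.
by rewrite gtr_pMl //; apply: lt_le_trans eta1 (sin_le1 _).
Qed.

Lemma angle_lower e eta a b : 0 < e <= 2^-1 -> 0 <= eta -> eta < sin (pi * e) ->
  0 < b -> a <= 1 -> b + e < a -> eta * sin (pi * a) < sin (pi * (a - b)).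
Proof.
move=> he eta0 eta1 b0 a1 ab; have [a1'|a1'] := eqVneq a 1.
  rewrite a1' mulr1 sinpi mulr0; apply: sinpi_gt0; case/andP: he => *; lra.
have := @angle_upper e eta (1 - a) (1 - b) he eta0 eta1.
rewrite sinpi_compl (_ : 1 - b - (1 - a) = a - b); last by ring.
apply; try lra.
Qed.

Lemma polar x y : 0 < y -> exists u r, [/\ 0 < u < 1, 0 < r,
  x = r * cos (pi * u) & y = r * sin (pi * u)].
Proof.
move=> y0; pose r := Num.sqrt (x ^+ 2 + y ^+ 2).
have y2 : 0 < y ^+ 2 by exact: exprn_gt0.
have s0 : 0 < x ^+ 2 + y ^+ 2 by rewrite ltr_wpDl // sqr_ge0.
have r0 : 0 < r by rewrite sqrtr_gt0.
have r2 : r ^+ 2 = x ^+ 2 + y ^+ 2 by rewrite sqr_sqrtr // ltW.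
have xr2 : (x / r) ^+ 2 = 1 - (y / r) ^+ 2.
  rewrite !expr_div_n r2; field; lra.
have yr0 : 0 < y / r by exact: divr_gt0.
have xr : `|x / r| < 1.
  rewrite -(@ltr_pXn2r _ 2) ?nnegrE // real_normK ?num_real // xr2 expr1n.
  by rewrite ltrBlDr ltrDl exprn_gt0.
move: (xr); rewrite ltr_norml => /andP[x1 x2].
have x12 : -1 <= x / r <= 1 by rewrite !ltW.
have p0 := pi_gt0 R.
exists (acos (x / r) / pi), r; rewrite mulrCA mulfV ?gt_eqF // mulr1; split=> //.
- rewrite divr_gt0 ?acos_gt0 ?x2 ?(ltW x1) //= ltr_pdivrMr // mul1r.
  by rewrite acos_ltpi // x1 ltW.
- by rewrite acosK ?in_itv //= mulrC divfK // gt_eqF.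
- rewrite sin_acos // xr2 opprB addrC subrK sqrtr_sqr gtr0_norm //.
  by rewrite mulrC divfK // gt_eqF.
Qed.

(** The imaginary part of [e^(- i pi d) (x + i y)]. For [d] and the phase of [x + i y] both in
    [(0, 1]], its sign compares that phase with [d]. *)
Definition cross d x y := y * cos (pi * d) - x * sin (pi * d).

Lemma cross_polar d b r z : cross d (r * cos (pi * b) + z) (r * sin (pi * b)) =
  r * sin (pi * (b - d)) - z * sin (pi * d).
Proof. by rewrite /cross mulrBr sinB; ring. Qed.

Lemma crossD d x y x' y' : cross d (x + x') (y + y') = cross d x y + cross d x' y'.
Proof. by rewrite /cross; ring. Qed.

Lemma cross_scale d r x y : cross d x y * r = y * (r * cos (pi * d)) - x * (r * sin (pi * d)).
Proof. by rewrite /cross; ring. Qed.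

(** A phase in [(0, 1]] cannot be at least [d1] and at most [d2 < d1]. The two signs combine to
    [y sin (pi (d1 - d2)) <= 0], hence [y = 0], and then the sign at [d2] contradicts [x < 0]. *)
Lemma cross_between d1 d2 x y : 0 < d2 -> d2 < d1 -> d1 <= 1 -> 0 <= y ->
  (y = 0 -> x < 0) -> 0 <= cross d1 x y -> cross d2 x y <= 0 -> False.
Proof.
move=> d20 d21 d11 y0 yx c1 c2.
have s2 : 0 < sin (pi * d2) by apply: sinpi_gt0; lra.
have s1 : 0 <= sin (pi * d1) by apply: sinpi_ge0; lra.
have s12 : 0 < sin (pi * (d1 - d2)) by apply: sinpi_gt0; lra.
have e : y * sin (pi * (d1 - d2)) = cross d2 x y * sin (pi * d1) - cross d1 x y * sin (pi * d2).
  by rewrite mulrBr sinB /cross; ring.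
have h1 := mulr_le0_ge0 c2 s1; have h2 := mulr_ge0 c1 (ltW s2).
have : y * sin (pi * (d1 - d2)) <= 0 by rewrite e; lra.
rewrite pmulr_lle0 // => yle; have {}y0 : y = 0 by apply/eqP; rewrite eq_le yle y0.
have := yx y0; move: c2; rewrite /cross y0 mul0r add0r oppr_le0 => h3 h4.
by have := pmulr_llt0 x s2; rewrite h4 ltNge h3.
Qed.

End Angles.

(** * Deforming the real part on a fixed heart *)

Section Heart.
Variables (R : realType) (D : triangulated) (P : slicing R D) (m : nat).
Variable cl : D -> 'rV[int]_m.
Hypothesis cl_tri : forall A B C, tri A B C -> cl B = cl A + cl C.
Variables (Q : 'rV[R]_m -> R) (p p' q : 'cV[R]_m) (a c eta e : R).
Hypothesis hQ : is_quadratic_form Q.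

Let L E := latR R (cl E).
Let x E := ev p (L E).
Let x' E := ev p' (L E).
Let y E := ev q (L E).

Hypothesis hZ : forall phi E, semistable P phi E ->
  exists r, [/\ 0 < r, x E = r * cos (pi * (phi - a)) & y E = r * sin (pi * (phi - a))].
Hypothesis hQs : forall phi E, semistable P phi E -> 0 <= Q (L E).
Hypothesis c0 : 0 < c.
(** At [t = 0] this bounds classes of subobjects; for every [t] it excludes nonzero vectors with
    [Q >= 0] from the kernel of the intermediate charge. *)
Hypothesis hc : forall t z, 0 <= t <= 1 -> 0 <= Q z ->
  c * l1norm z <= `|ev (p + t *: (p' - p)) z| + `|ev q z|.
Hypothesis hd : forall z, 0 <= Q z ->
  `|ev p' z - ev p z| <= eta / 2 * (`|ev p z| + `|ev q z|).
Hypothesis he : 0 < e <= 2^-1.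
Hypothesis eta0 : 0 <= eta.
Hypothesis eta_e : eta < sin (pi * e).

Let eta1 : eta < 1.
Proof. exact: lt_le_trans eta_e (sin_le1 _). Qed.

Lemma L_tri A B C : tri A B C -> L B = L A + L C.
Proof. by move=> /cl_tri; rewrite /L => ->; apply/rowP => i; rewrite !mxE intrD. Qed.

Lemma L_zero E : is_zero E -> L E = 0.
Proof.
by move=> z; apply: (@addrI _ (L E)); rewrite addr0 -(L_tri (tri_id0 E z)).
Qed.

Lemma x'_tri A B C : tri A B C -> x' B = x' A + x' C.
Proof. by move=> /L_tri h; rewrite /x' h evD. Qed.
Lemma y_tri A B C : tri A B C -> y B = y A + y C.
Proof. by move=> /L_tri h; rewrite /y h evD. Qed.
Lemma x'_zero E : is_zero E -> x' E = 0. Proof. by move=> /L_zero h; rewrite /x' h ev0. Qed.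
Lemma y_zero E : is_zero E -> y E = 0. Proof. by move=> /L_zero h; rewrite /y h ev0. Qed.

Lemma L_iso A B : isomorphic A B -> L A = L B.
Proof.
have [Z zZ] := has_zero D.
move=> i; have t : tri A B Z.
  by apply: tri_iso (tri_id0 A zZ) => //; exact: iso_refl.
by rewrite (L_tri t) (L_zero zZ) addr0.
Qed.

Lemma semistable_polar phi E : semistable P phi E -> exists r z, [/\ 0 < r, `|z| <= eta * r,
  x E = r * cos (pi * (phi - a)), y E = r * sin (pi * (phi - a)) & x' E = x E + z].
Proof.
move=> sE; have [r [r0 xE yE]] := hZ sE; exists r, (x' E - x E); split=> //; last first.
  by rewrite addrC subrK.
apply: le_trans (hd (hQs sE)) _; rewrite -/(x E) -/(y E) xE yE !normrM gtr0_norm //.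
(* Cosine and sine add up to at most [2] in absolute value, which cancels the [2] in [eta / 2]. *)
have := lerD (cos_max (pi * (phi - a))) (sin_max (pi * (phi - a))).
by move=> /(ler_wpM2l (mulr_ge0 eta0 (ltW r0))) /=; lra.
Qed.

Definition in_heart E := upper P (fun t => a < t) E /\ lower P (fun t => a + 1 < t) E.

Lemma in_heart_ext A B C : tri A B C -> in_heart A -> in_heart C -> in_heart B.
Proof.
move=> t [uA lA] [uC lC]; split; [exact: upper_ext t uA uC|exact: lower_ext t lA lC].
Qed.

Lemma in_heart_zero E : is_zero E -> in_heart E.
Proof. by move=> z; split; [exact: upper_zero|exact: lower_zero]. Qed.

Lemma in_heart_iso A B : isomorphic A B -> in_heart A -> in_heart B.
Proof. by move=> i [u l]; split; [exact: upper_iso i u|exact: lower_iso i l]. Qed.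

Lemma slice_in_heart phi E : a < phi <= a + 1 -> P phi E -> in_heart E.
Proof.
move=> /andP[h1 h2] PE; split; [apply: slice_upper PE h1 => //|apply: slice_lower PE _ => //].
by rewrite ltNge h2.
Qed.

Lemma in_heart_hn s E : in_heart E -> hn P s E -> forall t, t \in s -> a < t <= a + 1.
Proof.
move=> [uE lE] hE t ts; rewrite (upper_hn _ uE hE ts) //= leNgt; apply/negP.
exact: lower_hn lE hE _ ts.
Qed.

Lemma hn_y_ge0 s E : hn P s E -> (forall t, t \in s -> a < t <= a + 1) ->
  0 <= y E /\ (y E = 0 -> forall t, t \in s -> t = a + 1).
Proof.
elim=> {s E} [E z _|s phi A E F hA IH t PF nF ls Hs]; first by rewrite y_zero.
have [yA yA0] := IH (fun t ts => Hs t (mem_behead (s := phi :: s) ts)).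
have /andP[f1 f2] := Hs _ (mem_head _ _).
have [r [r0 _ yF]] := hZ (conj PF nF).
have sF : 0 <= sin (pi * (phi - a)) by apply: sinpi_ge0; lra.
have yF0 : 0 <= y F by rewrite yF mulr_ge0 // ltW.
rewrite (y_tri t); split=> [|y0]; first exact: addr_ge0.
have {}yA0 : y A = 0 by lra.
have {}yF0 : y F = 0 by lra.
move=> u; rewrite inE => /orP[/eqP->|]; last first.
  by have [_ /(_ yA0)] := IH (fun t ts => Hs t (mem_behead (s := phi :: s) ts)); exact.
apply/eqP; rewrite eq_le f2 leNgt; apply/negP => f3.
have : 0 < sin (pi * (phi - a)) by apply: sinpi_gt0; lra.
by move=> /(mulr_gt0 r0); rewrite -yF yF0 ltxx.
Qed.

Lemma y_ge0 E : in_heart E -> 0 <= y E.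
Proof.
move=> iE; have [s hs] := hn_ex P E.
by have [] := hn_y_ge0 hs (in_heart_hn iE hs).
Qed.

Lemma y_eq0 E : in_heart E -> y E = 0 -> P (a + 1) E.
Proof.
move=> iE yE; have [s hs] := hn_ex P E.
have [_ /(_ yE) H] := hn_y_ge0 hs (in_heart_hn iE hs).
apply: slice_of_bounds; last exact: iE.2.
by apply: hn_upper hs _ => // t /H ->.
Qed.

(** At phase [a + 1] the rotated charge is [- r], and a perturbation of size [eta r < r] keeps it
    negative. This boundary case makes the new charge a stability function on the heart. *)
Lemma top_charge E : P (a + 1) E -> ~ is_zero E -> x' E < 0 /\ y E = 0.
Proof.
move=> PE nE; have [r [z [r0 zr xE yE x'E]]] := semistable_polar (conj PE nE).
rewrite x'E xE yE (_ : a + 1 - a = 1); last by ring.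
rewrite mulr1 cospi sinpi mulr0; split=> //.
move: zr; rewrite ler_norml => /andP[_ z1].
have : eta * r < r by rewrite gtr_pMl.
lra.
Qed.

(** Within the heart this cuts out [P((a, a + 1))], where nonzero objects have [y > 0], so that
    slopes are finite. *)
Definition below_top E := lower P (fun t => a + 1 <= t) E.

Lemma below_top_y E : in_heart E -> below_top E -> ~ is_zero E -> 0 < y E.
Proof.
move=> iE bE nE; rewrite lt_neqAle y_ge0 // andbT; apply/negP => /eqP/esym yE.
have PE := y_eq0 iE yE; apply: nE; apply: upper_lower_zero bE => //.
exact: slice_upper PE _.
Qed.

Lemma heart_charge E : in_heart E -> ~ is_zero E -> 0 <= y E /\ (y E = 0 -> x' E < 0).
Proof.
move=> iE nE; split=> [|yE]; first exact: y_ge0.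
by have [] := top_charge (y_eq0 iE yE) nE.
Qed.

Lemma sub_below_top A E B : in_heart B -> tri A E B -> below_top E -> below_top A.
Proof.
by move=> [_ lB] t bE; apply: lower_sub t bE lB _ => u; lra.
Qed.

Lemma top_decomposition E : in_heart E ->
  exists T E'', [/\ P (a + 1) T, in_heart T, in_heart E'', below_top E'' & tri T E E''].
Proof.
move=> [uE lE].
have [T [E'' [uT lE'' t]]] := truncation P E (@up_closed_ge R (a + 1)).
have lT : lower P (fun t => a + 1 < t) T by apply: lower_sub t lE lE'' _ => u; lra.
have uT' : upper P (fun t => a < t) T by apply: upperW uT => u; lra.
exists T, E''; split=> //; first exact: slice_of_bounds uT lT.
split; first by apply: upper_quot t uE uT _ => u; lra.
by apply: lowerW lE'' => u; exact: ltW.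
Qed.

(** * Semistability in the heart for the deformed charge *)

Definition crossE phi E := cross (phi - a) (x' E) (y E).

Lemma crossE_tri phi A B C : tri A B C -> crossE phi B = crossE phi A + crossE phi C.
Proof. by move=> t; rewrite /crossE (x'_tri t) (y_tri t) crossD. Qed.

Lemma crossE_zero phi E : is_zero E -> crossE phi E = 0.
Proof. by move=> z; rewrite /crossE /cross x'_zero // y_zero // !mul0r subrr. Qed.

(* Subobjects in the heart are given by the triangles with all vertices in it. *)
Definition deformed phi E := [/\ in_heart E,
  exists r, [/\ 0 <= r, x' E = r * cos (pi * (phi - a)) & y E = r * sin (pi * (phi - a))]
  & forall A B, in_heart A -> in_heart B -> tri A E B -> crossE phi A <= 0].

Lemma deformed_cross phi E : deformed phi E -> crossE phi E = 0.
Proof. by move=> [_ [r [_ xE yE]] _]; rewrite /crossE xE yE /cross; ring. Qed.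

Lemma deformed_iso phi E F : isomorphic E F -> deformed phi E -> deformed phi F.
Proof.
move=> i [iE [r [r0 xE yE]] H]; split; first exact: in_heart_iso i iE.
  by exists r; rewrite /x' /y -(L_iso i).
move=> A B iA iB t; apply: (H A B) => //.
by apply: tri_iso t; [exact: iso_refl|exact: iso_sym|exact: iso_refl].
Qed.

Lemma deformed_zero phi E : is_zero E -> deformed phi E.
Proof.
move=> z; split; first exact: in_heart_zero.
  by exists 0; rewrite x'_zero // y_zero // !mul0r.
move=> A B iA iB t; rewrite crossE_zero //; apply/shift_zero.
(* [B] is isomorphic to [A[1]], so it lies in the heart and in its shift, hence is zero. *)
have i := tri_zero1 (tri_rot t) z.
apply: (@upper_lower_zero _ _ P (fun t => a + 1 < t)) => //; last exact: lower_iso i iB.2.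
by apply/(@upper_shift _ _ P (fun t => a < t)); [move=> u; lra|exact: iA.1].
Qed.

(** The cone of [f] has phases in [(a, a + 2]]. Its part above [a + 1] is the shifted kernel, the
    rest is the cokernel [C], and the image is the fibre of [B -> C]. If that fibre vanishes,
    [B -> C] is invertible and kills [f]. *)
Lemma heart_image A B (f : hom A B) : in_heart A -> in_heart B ->
  exists K I C, [/\ in_heart K, in_heart I, in_heart C, tri K A I /\ tri I B C
    & is_zero I -> f = 0].
Proof.
move=> [uA lA] [uB lB]; have [C0 [g [h d]]] := dist_ex f.
have t0 : tri A B C0 by exists f, g, h.
have uA1 : upper P (fun t => a + 1 < t) (shift A).
  by rewrite (upper_shift _ (U := fun t => a < t)) => // u; lra.
have lA1 : lower P (fun t => a + 2 < t) (shift A).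
  by rewrite (lower_shift _ (U := fun t => a + 1 < t)) => // u; lra.
have uC0 : upper P (fun t => a < t) C0.
  by apply: upper_ext (tri_rot t0) uB _; apply: upperW uA1 => u; lra.
have lC0 : lower P (fun t => a + 2 < t) C0.
  by apply: lower_ext (tri_rot t0) _ lA1; apply: lowerW lB => u; lra.
have [K1 [C [uK1 lC tC]]] := truncation P C0 (@up_closed_gt R (a + 1)).
have iC : in_heart C by split=> //; apply: upper_quot tC uC0 uK1 _ => u; lra.
have lK1 : lower P (fun t => a + 2 < t) K1 by apply: lower_sub tC lC0 lC _ => u; lra.
have [K iK] := shift_es K1.
have hK : in_heart K.
  split.
    apply/(@upper_shift _ _ P (fun t => a < t) (fun t => a + 1 < t)) => [u|]; first lra.
    exact: upper_iso iK uK1.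
  apply/(@lower_shift _ _ P (fun t => a + 1 < t) (fun t => a + 2 < t)) => [u|]; first lra.
  exact: lower_iso iK lK1.
have [f' [g' [h' d']]] := tC.
have [I [i [k [dI tI]]]] := tri_quot_map d d'.
have tIC : tri I B C by exists i, (comp g' g), k.
exists K, I, C; split=> //.
- split; first by apply: upper_ext tI uA _; apply: upperW uK1 => u; lra.
  by apply: lower_sub tIC lB lC _ => u; lra.
- split=> //; apply: tri_rotl; apply: tri_iso tI; [exact: iso_refl|exact: iso_refl|exact: iK].
- move=> zI; have [w [wgg _]] := dist_zero3 (dist_rotr dI) (proj2 (shift_zero I) zI).
  by rewrite -(comp1m f) -wgg -!compA (dist_comp0 d) !compm0.
Qed.

(** The image of a nonzero map would have phase at least [phi1] as a quotient of [E1] and at most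
    [phi2] as a subobject of [E2]. *)
Lemma deformed_hom0 phi1 phi2 E1 E2 : a < phi2 -> phi2 < phi1 -> phi1 <= a + 1 ->
  deformed phi1 E1 -> deformed phi2 E2 -> hom0 E1 E2.
Proof.
move=> h1 h2 h3 d1 d2 f; have [i1 _ H1] := d1; have [i2 _ H2] := d2.
have [K [I [C [iK iI iC [tK tC] zI]]]] := heart_image f i1 i2.
apply: zI; apply: contrapT => nI.
have cK := H1 _ _ iK iI tK; have cI := H2 _ _ iI iC tC.
have := crossE_tri phi1 tK; rewrite (deformed_cross d1) => e1.
have [yI xI] := heart_charge iI nI.
apply: (@cross_between R (phi1 - a) (phi2 - a) (x' I) (y I)) => //; try lra.
by rewrite -/(crossE phi1 I); lra.
Qed.

(** The old HN phases of [E] stay below some [f < a + 1], and so do those of every subobject. On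
    each factor [x >= - k y], which turns the bound by [|x| + y] into one linear in [x'] and [y];
    linear bounds add up over the factors. *)
Lemma subobject_bound E : in_heart E -> below_top E -> exists2 k : R, 0 <= k &
  forall A B, in_heart A -> in_heart B -> tri A E B -> c * l1norm (L A) <= 2 * x' A + k * y A.
Proof.
move=> iE bE; have [s hs] := hn_ex P E.
have sa t : t \in s -> a < t < a + 1.
  move=> ts; have /andP[-> _] := in_heart_hn iE hs ts.
  by rewrite ltNge; apply/negP; exact: lower_hn bE hs _ ts.
have [f [f1 f2 fs]] : exists f, [/\ a < f, f < a + 1 & forall t, t \in s -> t <= f].
  elim: s sa {hs} => [|t s IH] sa; first by exists (a + 2^-1); split=> //; lra.
  have [f [f1 f2 fs]] := IH (fun u us => sa u (mem_behead (s := t :: s) us)).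
  have /andP[t1 t2] := sa _ (mem_head _ _).
  exists (Num.max t f); rewrite lt_max gt_max t1 t2 f2; split=> // u.
  by rewrite inE le_max => /orP[/eqP->|/fs ->]; rewrite ?lexx ?orbT.
have sf : 0 < sin (pi * (f - a)) by apply: sinpi_gt0; lra.
pose k := `|cos (pi * (f - a))| / sin (pi * (f - a)).
have k0 : 0 <= k by rewrite divr_ge0 // ltW.
(* The coefficient results from [x - x' <= (|x| + y) / 2], doubled, together with
   [|x| <= x + 2 k y]. *)
exists (2 * (2 * k + 1)); first lra.
move=> A B iA iB tA.
have lE : lower P (fun t => f < t) E.
  by apply: hn_lower hs _ => // t /fs; rewrite leNgt => /negP.
have lA : lower P (fun t => f < t) A by apply: lower_sub tA lE iB.2 _ => u; lra.
have [t ht] := hn_ex P A.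
have : forall u, u \in t -> a < u <= f.
  move=> u ut; have /andP[-> _] := in_heart_hn iA ht ut.
  by rewrite /= leNgt; apply/negP; exact: lower_hn lA ht _ ut.
elim: ht => {t A B iA iB tA lA} [A zA _|t phi A B F _ IH tt PF nF _ Ht].
  by rewrite x'_zero // y_zero // L_zero // -(scale0r 0) l1normZ normr0; lra.
have := IH (fun t ts => Ht t (mem_behead (s := phi :: _) ts)).
have /andP[g1 g2] := Ht _ (mem_head _ _).
have [r [r0 xF yF]] := hZ (conj PF nF).
have sF : 0 <= sin (pi * (phi - a)) by apply: sinpi_ge0; lra.
have yF0 : 0 <= y F by rewrite yF mulr_ge0 // ltW.
have kF : - k * y F <= x F.
  have s1 : 0 <= sin (pi * (f - phi)) by apply: sinpi_ge0; lra.
  have : 0 <= sin (pi * (f - a)) * cos (pi * (phi - a)) - cos (pi * (f - a)) * sin (pi * (phi - a)).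
    by rewrite -sinB -mulrBr (_ : f - a - (phi - a) = f - phi) //; ring.
  move: (ler_norm (- cos (pi * (f - a)))); rewrite normrN => n1 s2.
  rewrite xF yF mulrCA ler_pM2l // -(ler_pM2l sf) mulrA mulrN /k mulrCA divff ?gt_eqF // mulr1.
  have := ler_wpM2r sF n1 => /=; lra.
have QF := hQs (conj PF nF).
have b1 := hc (_ : 0 <= 0 <= 1) QF; have b2 := hd QF.
  move: b1; rewrite lexx ler01 scale0r addr0 -/(x F) -/(y F) => /(_ isT) b1.
  rewrite -/(x F) -/(x' F) -/(y F) (ger0_norm yF0) in b1 b2.
  have x0 := normr_ge0 (x F).
  have b3 : eta / 2 * (`|x F| + y F) <= 2^-1 * (`|x F| + y F).
    by apply: ler_wpM2r; [exact: addr_ge0|have := eta1; lra].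
  have b4 : - (x' F - x F) <= 2^-1 * (`|x F| + y F).
    by apply: le_trans b3; apply: le_trans b2; rewrite -normrN ler_norm.
  have b5 : `|x F| <= x F + 2 * (k * y F).
    have ky : 0 <= k * y F by exact: mulr_ge0.
    by case: (leP 0 (x F)) => h; [rewrite ger0_norm|rewrite ltr0_norm] => //; lra.
  have bF : c * l1norm (L F) <= 2 * x' F + 2 * (2 * k + 1) * y F by lra.
  move=> bA; rewrite (x'_tri tt) (y_tri tt) (L_tri tt).
  by have := ler_wpM2l (ltW c0) (l1normD (L A) (L F)); lra.
Qed.

Lemma subobjects_finite E M : in_heart E -> below_top E -> exists l : seq 'rV[int]_m,
  forall A B, in_heart A -> in_heart B -> tri A E B -> x' A <= M -> cl A \in l.
Proof.
move=> iE bE; have [k k0 H] := subobject_bound iE bE.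
have [l Hl] := lattice_finite m ((2 * M + k * y E) / c).
exists l => A B iA iB t xM; apply: Hl; rewrite ler_pdivlMr // mulrC.
apply: le_trans (H _ _ iA iB t) _; apply: lerD; first by rewrite ler_pM2l.
by apply: ler_wpM2l => //; rewrite (y_tri t) lerDl y_ge0.
Qed.

(* The comparisons of slopes [- x' / y] are written without division. *)
Lemma maximal_destabilizing E : in_heart E -> below_top E -> ~ is_zero E ->
  exists A B, [/\ in_heart A, in_heart B, tri A E B, ~ is_zero A &
     x' A * y E <= x' E * y A /\
     forall A' B', in_heart A' -> in_heart B' -> tri A' E B' -> ~ is_zero A' ->
       x' A * y A' <= x' A' * y A /\ (x' A * y A' = x' A' * y A -> y A' <= y A)].
Proof.
move=> iE bE nE; have yE := below_top_y iE bE nE.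
have [l Hl] := subobjects_finite `|x' E| iE bE.
pose f w := - ev p' (latR R w) / ev q (latR R w).
(* Only subobjects of slope at least that of [E] are known to have their class in [l]. [E] is one of
   them, and a subobject of smaller slope is compared with [A] through [E]. *)
pose good w := exists A B, [/\ in_heart A, in_heart B, tri A E B, ~ is_zero A &
  cl A = w /\ x' A * y E <= x' E * y A].
have ysub A B : in_heart A -> in_heart B -> tri A E B -> ~ is_zero A -> 0 < y A.
  by move=> iA iB t; apply: below_top_y => //; exact: sub_below_top t bE.
have inl A B : in_heart A -> in_heart B -> tri A E B -> x' A * y E <= x' E * y A -> cl A \in l.
  move=> iA iB t h; apply: (Hl _ _ iA iB t).
  rewrite -(ler_pM2r yE); apply: le_trans h _.
  apply: (@le_trans _ _ (`|x' E| * y A)); first by apply: ler_wpM2r; [exact: y_ge0|exact: ler_norm].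
  by apply: ler_wpM2l => //; rewrite (y_tri t) lerDl; exact: y_ge0.
have [Z zZ] := has_zero D.
have tEZ := tri_id0 E zZ; have iZ := in_heart_zero zZ.
have [|w1 [w1l g1 m1]] := @seq_max R _ l good f.
  exists (cl E); split; first exact: inl iE iZ tEZ _.
  by exists E, Z; split.
(* Among the classes of maximal slope one with the largest [y] is taken; this makes subobjects of
   the quotient have strictly smaller slope. *)
have [|w [wl [g fw] m2]] := @seq_max R _ l (fun w => good w /\ f w = f w1) (fun w => ev q (latR R w)).
  by exists w1.
have [A [B [iA iB t nA [Aw chA]]]] := g.
exists A, B; split=> //; split=> // A' B' iA' iB' t' nA'.
have yA := ysub _ _ iA iB t nA; have yA' := ysub _ _ iA' iB' t' nA'.
have [ch'|ch'] := leP (x' A' * y E) (x' E * y A').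
  have l' := inl _ _ iA' iB' t' ch'.
  have g' : good (cl A') by exists A', B'.
  have fA : f w = - x' A / y A by rewrite /f -Aw.
  have fA' : f (cl A') = - x' A' / y A' by [].
  have := m1 _ l' g'; rewrite -fw fA fA' !mulNr lerN2 ler_pdivrMr // mulrAC ler_pdivlMr //.
  move=> h; split=> // xy; rewrite -(Aw : cl A = w) in m2; apply: m2 => //; split=> //.
  rewrite -fw fA fA' !mulNr; congr (- _); apply/eqP.
  by rewrite eqr_div ?lt0r_neq0 // xy.
have h : x' A * y A' < x' A' * y A.
  rewrite -(ltr_pM2r yE) mulrAC (mulrAC _ (y A)); apply: le_lt_trans (_ : x' E * y A' * y A < _).
    by rewrite (mulrAC (x' E)) ler_pM2r.
  by rewrite ltr_pM2r.
by split=> [|xy]; [exact: ltW|rewrite xy ltxx in h].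
Qed.

Definition heart_slice phi E := a < phi <= a + 1 /\ deformed phi E.

Lemma hn_below_top E : in_heart E -> below_top E -> exists s, [/\ hn heart_slice s E,
  forall t, t \in s -> a < t < a + 1 &
  forall f, a < f < a + 1 ->
    (forall A B, in_heart A -> in_heart B -> tri A E B -> ~ is_zero A -> crossE f A < 0) ->
    forall t, t \in s -> t < f].
Proof.
move=> iE bE; have [z|nE] := pselect (is_zero E).
  by exists [::]; split=> //; exact: hn_nil.
have [l Hl] := subobjects_finite `|x' E| iE bE.
have {Hl} Hl A B : in_heart A -> in_heart B -> tri A E B ->
    x' A * y E <= x' E * y A -> cl A \in l.
  move=> iA iB t h.
  apply: (Hl _ _ iA iB t); have yE := below_top_y iE bE nE.
  rewrite -(ler_pM2r yE); apply: le_trans h _.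
  apply: (@le_trans _ _ (`|x' E| * y A)).
    by apply: ler_wpM2r; [exact: y_ge0|exact: ler_norm].
  by apply: ler_wpM2l => //; rewrite (y_tri t) lerDl; exact: y_ge0.
have [n ln] := ubnP (size l); elim: n => // n IH in E l ln iE bE Hl {nE} *.
have [z|nE] := pselect (is_zero E).
  by exists [::]; split=> //; exact: hn_nil.
have [A [B [iA iB t nA [chA mA]]]] := maximal_destabilizing iE bE nE.
have bA := sub_below_top iB t bE.
have yA := below_top_y iA bA nA.
have [u [r [/andP[u0 u1] r0 xA yAE]]] := polar (x' A) yA.
pose f := a + u; have fa : f - a = u by rewrite /f; ring.
have crf E' : crossE f E' * r = y E' * x' A - x' E' * y A.
  by rewrite /crossE cross_scale fa -xA -yAE.
have ssA : deformed f A.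
  split=> //; first by exists r; rewrite fa; split=> //; exact: ltW.
  move=> A' B' iA' iB' t'; have [z'|nA'] := pselect (is_zero A'); first by rewrite crossE_zero.
  have [W tW tW'] := tri_sub_sub t' t.
  have iW := in_heart_ext tW' iB' iB.
  have [h _] := mA _ _ iA' iW tW nA'.
  by rewrite -(pmulr_lle0 _ r0) crf; lra.
have iZ E' : is_zero E' -> in_heart E' by exact: in_heart_zero.
have sA : heart_slice f A by split=> //; rewrite /f; lra.
have hA : hn heart_slice [:: f] A by exact: hn1.
have fE g : a < g < a + 1 ->
    (forall A B, in_heart A -> in_heart B -> tri A E B -> ~ is_zero A -> crossE g A < 0) -> f < g.
  move=> /andP[g0 g1] /(_ _ _ iA iB t nA); rewrite /crossE xA yAE.
  rewrite -{1}(addr0 (r * _)) cross_polar mul0r subr0 pmulr_rlt0 // => sn.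
  rewrite ltNge; apply/negP => gf.
  have : 0 <= sin (pi * (u - (g - a))) by apply: sinpi_ge0; move: gf; rewrite /f; lra.
  by rewrite leNgt sn.
(* The preimage in [E] of a subobject [T] of top phase has the same [y] as [A] and smaller [x'],
   against the maximality of the slope of [A]. *)
have bB : below_top B.
  have [T [B2 [PT iT iB2 bB2 tB]]] := top_decomposition iB.
  have [zT|nT] := pselect (is_zero T).
    by apply: lower_iso bB2; apply: iso_sym; exact: tri_zero1 tB zT.
  have [E' tE' tA'] := tri_quot t tB.
  have iE' := in_heart_ext tA' iA iT.
  have [xT yT] := top_charge PT nT.
  have yE' : y E' = y A by rewrite (y_tri tA') yT addr0.
  have nE' : ~ is_zero E' by move=> zE'; move: yA; rewrite -yE' y_zero // ltxx.
  have [+ _] := mA _ _ iE' iB2 tE' nE'.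
  by rewrite yE' ler_pM2r // (x'_tri tA'); lra.
have subB B' B2 : in_heart B' -> in_heart B2 -> tri B' B B2 -> ~ is_zero B' ->
    x' A * y B' < x' B' * y A.
  move=> iB' iB2 tB nB'; have [E' tE' tA'] := tri_quot t tB.
  have iE' := in_heart_ext tA' iA iB'.
  have yB' : 0 < y B' by apply: below_top_y => //; exact: sub_below_top tB bB.
  have yE' : y E' = y A + y B' by exact: y_tri.
  have nE' : ~ is_zero E' by move=> zE'; move: yE'; rewrite y_zero //; lra.
  have [h1 h2] := mA _ _ iE' iB2 tE' nE'.
  have : x' A * y E' < x' E' * y A.
    by rewrite lt_neqAle h1 andbT; apply/negP => /eqP/h2; rewrite yE'; lra.
  by rewrite yE' (x'_tri tA'); lra.
have [zB|nB] := pselect (is_zero B).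
  exists [:: f]; split; first by apply: hn_iso hA; exact: tri_zero3 t zB.
    by move=> g; rewrite inE => /eqP ->; rewrite /f; lra.
  by move=> g ga Hg g'; rewrite inE => /eqP ->; exact: fE Hg.
have yB := below_top_y iB bB nB.
(* The class [0] belongs to [l] through the zero subobject, but a preimage [E'] containing [A] has
   [y > 0]; removing [0] makes the list shorter. *)
pose l' := [seq w - cl A | w <- rem 0 l].
have [||s [hs sa sf]] := IH B l' _ iB bB.
  have l0 : 0 \in l.
    have [Z zZ] := has_zero D; have t0 := tri_0id E zZ.
    have cZ : cl Z = 0.
      by apply: (@addrI _ (cl Z)); rewrite addr0 -(cl_tri (tri_id0 Z zZ)).
    by rewrite -cZ; apply: (Hl _ _ (iZ _ zZ) iE t0); rewrite (x'_zero zZ) (y_zero zZ) mul0r mulr0.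
  by rewrite size_map size_rem //; case: (l) l0 ln.
  move=> B' B2 iB' iB2 tB ch.
  have [E' tE' tA'] := tri_quot t tB.
  have iE' := in_heart_ext tA' iA iB'.
  apply/mapP; exists (cl E'); last by rewrite (cl_tri tA') addrC addKr.
  have yB'0 := y_ge0 iB'.
  apply: rem_mem.
    apply/eqP => c0'; have : y E' = 0.
      by rewrite /y /L c0' (_ : latR R 0 = 0) ?ev0 //; apply/rowP => i; rewrite !mxE.
    by rewrite (y_tri tA'); lra.
  apply: (Hl _ _ iE' iB2 tE').
  have yB2 := y_ge0 iB2; have yBE := y_tri tB.
  move: chA; rewrite (x'_tri t) (y_tri t) (x'_tri tA') (y_tri tA') => chA.
  (* [A] and [B'] both have slope at least that of [B], and [y B' <= y B]. After multiplication by
     [y B > 0], the required difference is exactly the sum of the products in [h1], [h2], [h3]. *)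
  rewrite -subr_ge0 -(pmulr_lge0 _ yB).
  have h1 : 0 <= (y B - y B') * (y A * x' B - x' A * y B) by apply: mulr_ge0; lra.
  have h2 : 0 <= y A * (x' B * y B' - x' B' * y B) by apply: mulr_ge0; lra.
  have h3 : 0 <= y B * (x' B * y B' - x' B' * y B) by apply: mulr_ge0; lra.
  by lra.
have lf : forall g, g \in s -> g < f.
  apply: sf; first by rewrite /f; lra.
  move=> B' B2 iB' iB2 tB nB'; rewrite -(pmulr_llt0 _ r0) crf.
  by have := subB _ _ iB' iB2 tB nB'; lra.
exists (s ++ [:: f]); split.
- by apply: hn_cat hs hA t _ => g g' gs; rewrite inE => /eqP ->; exact: lf.
- by move=> g; rewrite mem_cat inE => /orP[/sa//|/eqP ->]; rewrite /f; lra.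
- move=> g ga Hg g'; have fg := fE _ ga Hg.
  rewrite mem_cat inE => /orP[/lf h|/eqP ->//]; exact: lt_trans h fg.
Qed.

Lemma top_deformed T : P (a + 1) T -> heart_slice (a + 1) T.
Proof.
move=> PT; have iT : in_heart T by apply: slice_in_heart PT; lra.
split; first lra.
have [z|nT] := pselect (is_zero T); first exact: deformed_zero.
have [xT yT] := top_charge PT nT; split=> //.
  exists (- x' T); rewrite (_ : a + 1 - a = 1); last by ring.
  by rewrite mulr1 cospi sinpi; split; lra.
move=> A B iA iB t; rewrite /crossE /cross (_ : a + 1 - a = 1); last by ring.
by rewrite mulr1 cospi sinpi mulr0; have := y_ge0 iA; lra.
Qed.

Lemma hn_heart E : in_heart E -> exists2 s, hn heart_slice s E &
  forall t, t \in s -> a < t <= a + 1.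
Proof.
move=> iE; have [T [E2 [PT iT iE2 bE2 t]]] := top_decomposition iE.
have [s [hs sa _]] := hn_below_top iE2 bE2.
have sa' u : u \in s -> a < u <= a + 1 by move=> /sa /andP[-> /ltW].
have [z|nT] := pselect (is_zero T).
  by exists s => //; apply: hn_iso hs; apply: iso_sym; exact: tri_zero1 t z.
exists (s ++ [:: a + 1]).
  apply: hn_cat hs (hn1 (top_deformed PT) nT) t _ => u v /sa /andP[_ h].
  by rewrite inE => /eqP ->.
by move=> u; rewrite mem_cat inE => /orP[/sa'//|/eqP->]; lra.
Qed.

(** If the part [A] of [E] above old phase [phi + e] were nonzero, then by [angle_upper] each of its
    factors would keep a positive [crossE phi] under the perturbation, so that [A] would destabilise
    [E]. Dually, [angle_lower] handles the quotient below [phi - e]. Near the ends of the heart its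
    own bounds suffice. *)
Lemma deformed_bounds phi E : heart_slice phi E ->
  lower P (fun t => phi + e < t) E /\ upper P (fun t => phi - e <= t) E.
Proof.
move=> [/andP[f0 f1] dE]; have [iE _ subE] := dE; have [uE lE] := iE; have /andP[e0 e2] := he.
split.
  have [h|h] := leP (a + 1) (phi + e); first by apply: lowerW lE => u; lra.
  have [A [B [uA lB t]]] := truncation P E (@up_closed_gt R (phi + e)).
  have iA : in_heart A.
    by split; [apply: upperW uA => u; lra|apply: lower_sub t lE lB _ => u; lra].
  have iB : in_heart B.
    by split; [apply: upper_quot t uE uA _ => u; lra|apply: lowerW lB => u; lra].
  have [zA|nA] := pselect (is_zero A); first by apply: lower_iso lB; apply: iso_sym; exact: tri_zero1 t zA.
  have := subE _ _ iA iB t; have [s hs] := hn_ex P A.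
  have Hs := upper_hn (@up_closed_gt R (phi + e)) uA hs; have Hs' := in_heart_hn iA hs.
  suff : 0 <= crossE phi A /\ (s != [::] -> 0 < crossE phi A).
    move=> [_]; case: s hs {Hs Hs'} => [hs|g s _ /(_ isT) + h']; last by rewrite ltNge h'.
    by case: nA; inversion hs.
  elim: hs Hs Hs' {t uA lB iA iB nA} => {A s} [A zA|s g A E' F _ IH t PF nF _ H1 H2].
    by rewrite crossE_zero.
  have [IH1 _] := IH (fun t ts => H1 t (mem_behead (s := g :: s) ts))
    (fun t ts => H2 t (mem_behead (s := g :: s) ts)).
  suff : 0 < crossE phi F by rewrite (crossE_tri _ t); split=> [|_]; lra.
  have g1 := H1 _ (mem_head _ _); have /andP[g2 g3] := H2 _ (mem_head _ _).
  have [r [z [r0 zr xF yF x'F]]] := semistable_polar (conj PF nF).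
  have sp : 0 <= sin (pi * (phi - a)) by apply: sinpi_ge0; lra.
  rewrite /crossE x'F xF yF cross_polar.
  have : eta * sin (pi * (phi - a)) < sin (pi * (g - a - (phi - a))).
    by apply: angle_upper he eta0 eta_e _ _ _; lra.
  rewrite -(ltr_pM2l r0) => h1.
  have h2 := ler_wpM2r sp (le_trans (ler_norm z) zr); move: h2 => /= h2; lra.
have [h|h] := leP (phi - e) a; first by apply: upperW uE => u; lra.
have [A [B [uA lB t]]] := truncation P E (@up_closed_ge R (phi - e)).
have iA : in_heart A.
  by split; [apply: upperW uA => u; lra|apply: lower_sub t lE lB _ => u; lra].
have iB : in_heart B.
  by split; [apply: upper_quot t uE uA _ => u; lra|apply: lowerW lB => u; lra].
have [zB|nB] := pselect (is_zero B); first by apply: upper_iso uA; exact: tri_zero3 t zB.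
have := subE _ _ iA iB t; have := crossE_tri phi t; rewrite (deformed_cross dE).
have [s hs] := hn_ex P B.
have Hs := lower_hn (@up_closed_ge R (phi - e)) lB hs; have Hs' := in_heart_hn iB hs.
suff : crossE phi B <= 0 /\ (s != [::] -> crossE phi B < 0).
  move=> [_]; case: s hs {Hs Hs'} => [hs|g s _ /(_ isT)]; last by lra.
  by case: nB; inversion hs.
elim: hs Hs Hs' {t uA lB iA iB nB} => {B s} [B zB|s g A' B F _ IH t PF nF _ H1 H2].
  by rewrite crossE_zero.
have [IH1 _] := IH (fun t ts => H1 t (mem_behead (s := g :: s) ts))
  (fun t ts => H2 t (mem_behead (s := g :: s) ts)).
suff : crossE phi F < 0 by rewrite (crossE_tri _ t); split=> [|_]; lra.
have /negP := H1 _ (mem_head _ _); rewrite -ltNge => g1.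
have /andP[g2 g3] := H2 _ (mem_head _ _).
have [r [z [r0 zr xF yF x'F]]] := semistable_polar (conj PF nF).
have sp : 0 <= sin (pi * (phi - a)) by apply: sinpi_ge0; lra.
rewrite /crossE x'F xF yF cross_polar -(opprB (phi - a)) mulrN sinN.
have : eta * sin (pi * (phi - a)) < sin (pi * (phi - a - (g - a))).
  by apply: angle_lower he eta0 eta_e _ _ _; lra.
rewrite -(ltr_pM2l r0) => h1.
have zr' : - z <= eta * r by apply: le_trans zr; rewrite -normrN ler_norm.
have h2 := ler_wpM2r sp zr'; move: h2 => /= h2; lra.
Qed.

Lemma deformed_support phi E : heart_slice phi E -> ~ is_zero E -> 0 <= Q (L E).
Proof.
move=> [/andP[f0 f1] dE] nE; have [iE [r [r0 xE yE]] subE] := dE.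
(* If [y E = 0], the object already lies in [P (a + 1)] and the old support property applies. *)
have [yE0|yE0] := eqVneq (y E) 0; first exact: hQs (conj (y_eq0 iE yE0) nE).
have {}yE0 : 0 < y E by rewrite lt_neqAle eq_sym yE0 y_ge0.
have f2 : phi < a + 1.
  rewrite lt_neqAle f1 andbT; apply/eqP => f2; move: yE0.
  by rewrite yE f2 (_ : a + 1 - a = 1) ?mulr1 ?sinpi ?mulr0 ?ltxx //; ring.
have sf : 0 < sin (pi * (phi - a)) by apply: sinpi_gt0; lra.
pose k := cos (pi * (phi - a)) / sin (pi * (phi - a)).
have cross_le A : crossE phi A <= 0 -> k * y A <= x' A.
  by rewrite /crossE /cross /k mulrAC ler_pdivrMr // mulrC; lra.
(* A nonzero part [T] of old phase [a + 1] has [y = 0] and [x' < 0], so it would violate the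
   semistability of [E]. *)
have bE : below_top E.
  have [T [E2 [PT iT iE2 bE2 t]]] := top_decomposition iE.
  have [zT|nT] := pselect (is_zero T).
    by apply: lower_iso bE2; apply: iso_sym; exact: tri_zero1 t zT.
  have [xT yT] := top_charge PT nT.
  have := cross_le _ (subE _ _ iT iE2 t); rewrite yT mulr0; lra.
have [s hs] := hn_ex P E.
have sa t : t \in s -> a < t < a + 1.
  move=> ts; have /andP[-> _] := in_heart_hn iE hs ts.
  by rewrite ltNge; apply/negP; exact: lower_hn bE hs _ ts.
pose g z := ev p z / ev q z.
have [Z zZ] := has_zero D.
(* Each step [E0] of the old HN filtration is carried along as a subobject of [E] with quotient in
   the heart, so that semistability of [E] supplies the inequalities of [psum]. *)
have main s' E0 : hn P s' E0 -> (forall t, t \in s' -> a < t < a + 1) ->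
    forall Z, in_heart Z -> tri E0 E Z ->
    exists2 M : seq 'rV[R]_m, [/\ \sum_(w <- M) w = L E0, psum (ev p') (ev q) k M &
    sorted (fun u w => g w <= g u) M] &
    forall w, w \in M -> [/\ 0 <= Q w, 0 < ev q w & exists2 t, t \in s' &
      g w = cos (pi * (t - a)) / sin (pi * (t - a))].
  elim=> {s' E0 s hs sa} [A zA _|s f A A' F hA IH t PF nF ls sa] Z1 iZ tE.
    by exists [::] => //; rewrite big_nil L_zero.
  have sa' u : u \in s -> a < u < a + 1 by move=> us; apply: sa; rewrite inE us orbT.
  have fa := sa _ (mem_head _ _).
  have iF : in_heart F by apply: slice_in_heart PF; lra.
  have [W tW tW'] := tri_sub_sub t tE.
  have iW := in_heart_ext tW' iF iZ.
  have [M [sM pM oM] HM] := IH sa' _ iW tW.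
  have [r' [r0' xF yF]] := hZ (conj PF nF).
  have sF : 0 < sin (pi * (f - a)) by apply: sinpi_gt0; lra.
  have gF : g (L F) = cos (pi * (f - a)) / sin (pi * (f - a)).
    rewrite /g -/(x F) -/(y F) xF yF -mulf_div divff ?mul1r // gt_eqF //.
  have SE : \sum_(w <- L F :: M) w = L A' by rewrite big_cons sM (L_tri t) addrC.
  have iA : in_heart A'.
    split.
      apply: (hn_upper (@up_closed_gt R a) (hn_cons hA t PF nF ls)) => u /sa; lra.
    apply: (hn_lower (@up_closed_gt R (a + 1)) (hn_cons hA t PF nF ls)) => u /sa h.
    by apply/negP; rewrite -leNgt; lra.
  exists (L F :: M).
    split=> //.
      rewrite /= -/(\sum_(w <- L F :: M) w) SE; split=> //.
      by apply: cross_le; exact: subE iA iZ tE.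
    rewrite /= path_sortedE; last by move=> u v w h1 h2; exact: le_trans h2 h1.
    rewrite oM andbT; apply/allP => w /HM[_ _ [u us ->]]; rewrite gF.
    have := allP ls _ us; have := sa' _ us => ua fu.
    have su : 0 < sin (pi * (u - a)) by apply: sinpi_gt0; lra.
    have suf : 0 <= sin (pi * (u - a - (f - a))) by apply: sinpi_ge0; lra.
    rewrite ler_pdivrMr // mulrAC ler_pdivlMr //.
    by move: suf; rewrite mulrBr sinB; lra.
  move=> w; rewrite inE => /orP[/eqP ->|/HM[h1 h2 [u us h3]]].
    split; [exact: hQs (conj PF nF)|by rewrite -/(y F) yF; exact: mulr_gt0|].
    by exists f => //; exact: mem_head.
  by split=> //; exists u => //; rewrite inE us orbT.
have [M [sM pM oM] HM] := main _ _ hs sa _ (in_heart_zero zZ) (tri_id0 E zZ).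
have merge t u v : 0 <= t <= 1 -> 0 <= Q u -> 0 <= Q v -> 0 < ev q u -> 0 < ev q v ->
    (ev p u + t * (ev p' u - ev p u)) / ev q u = (ev p v + t * (ev p' v - ev p v)) / ev q v ->
    0 <= Q (u + v).
  move=> t01 Qu Qv qu qv h.
  have evt w : ev (p + t *: (p' - p)) w = ev p w + t * (ev p' w - ev p w).
    by rewrite ev_addl ev_scalel ev_addl ev_oppl.
  apply: (quad_merge hQ (p := p + t *: (p' - p)) (q := q)) => //.
    move=> z z1 z2; rewrite leNgt; apply/negP => Qz.
    have := hc t01 (ltW Qz); rewrite z1 z2 normr0 addr0 pmulr_rle0 // => /l1norm_eq0 z0.
    by move: Qz; rewrite z0 (quad0 hQ) ltxx.
  by rewrite !evt; apply/eqP; rewrite -eqr_div ?lt0r_neq0 //; apply/eqP.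
rewrite -sM; apply: (@Good_sum R _ (ev p) (ev p') (ev q) (fun w => 0 <= Q w) _ _ _ merge k M 0).
- exact: evD.
- exact: evD.
- exact: evD.
- by rewrite lexx ler01.
- apply/eqP => M0; move: sM; rewrite M0 big_nil => L0.
  by move: yE0; rewrite /y -L0 ev0 ltxx.
- by move=> u /HM[].
- move: oM; congr (is_true (sorted _ M)); apply/funext => u; apply/funext => w.
  by rewrite !mul0r !addr0.
- exact: pM.
- rewrite sM -/(y E) -/(x' E) xE yE /k; field; exact: lt0r_neq0.
Qed.

End Heart.

(** * The deformed slicing *)

Section IntegerAngles.
Variable R : realType.
Implicit Types (k : int) (t : R).

Lemma sinpi_int k : sin (pi * k%:~R) = 0 :> R.
Proof.
have H (n : nat) : sin (pi * n%:R) = 0 :> R.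
  elim: n => [|n IH]; first by rewrite mulr0 sin0.
  by rewrite -natr1 mulrDr mulr1 sinDpi IH oppr0.
case: k => n; first exact: H.
by rewrite NegzE mulrNz mulrN sinN H oppr0.
Qed.

(** This is [(-1)^k]; as a cosine it fits the addition formulas for negative [k] too. *)
Definition parity k : R := cos (pi * k%:~R).

Lemma parity_sqr k : parity k * parity k = 1.
Proof. by have := cos2Dsin2 (pi * k%:~R : R); rewrite sinpi_int expr0n addr0 expr2. Qed.

Lemma parity_norm k : `|parity k| = 1.
Proof.
have := congr1 Num.norm (parity_sqr k); rewrite normrM normr1 => h.
have h0 := normr_ge0 (parity k); apply/eqP; rewrite -(@eqrXn2 _ 2) //.
by rewrite expr2 h expr1n.
Qed.

Lemma parityS k : parity (k + 1) = - parity k.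
Proof. by rewrite /parity intrD mulrDr mulr1 cosDpi. Qed.

Lemma cos_parity t k : cos (pi * (t - k%:~R)) = parity k * cos (pi * t).
Proof. by rewrite mulrBr cosB sinpi_int mulr0 addr0 mulrC. Qed.

Lemma sin_parity t k : sin (pi * (t - k%:~R)) = parity k * sin (pi * t).
Proof. by rewrite mulrBr sinB sinpi_int mulr0 subr0 mulrC. Qed.

Lemma int_interval (theta phi : R) : exists k, theta + k%:~R < phi <= theta + k%:~R + 1.
Proof.
(* The interval is open on the left, so [k] is the ceiling of [phi - theta], minus [1]. *)
exists (- Num.floor (theta - phi) - 1).
have h1 := floor_le_tmp (theta - phi); have h2 := floorD1_gt (theta - phi).
by move: h1 h2; rewrite !intrD intrN => h1 h2; lra.
Qed.

End IntegerAngles.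

Section HeartShift.
Variables (R : realType) (D : triangulated) (P : slicing R D) (m : nat).
Variable cl : D -> 'rV[int]_m.
Hypothesis cl_tri : forall A B C, tri A B C -> cl B = cl A + cl C.

Lemma cl_shift A : cl (shift A) = - cl A.
Proof.
have [Z zZ] := has_zero D.
have h1 := cl_tri (tri_rot (tri_id0 A zZ)); have h2 := cl_tri (tri_id0 Z zZ).
have e0 : cl Z = 0 by apply: (@addrI _ (cl Z)); rewrite addr0 -h2.
by apply/eqP; rewrite -addr_eq0 addrC -h1 e0.
Qed.

Lemma ev_shift (p : 'cV[R]_m) A : ev (- p) (latR R (cl (shift A))) = ev p (latR R (cl A)).
Proof.
rewrite cl_shift ev_oppl (_ : latR R (- cl A) = - latR R (cl A)) ?evN ?opprK //.
by apply/rowP => i; rewrite !mxE intrN.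
Qed.

Lemma in_heart_shift a E : in_heart P (a + 1) (shift E) <-> in_heart P a E.
Proof.
split=> -[u l]; split.
- by apply/(@upper_shift _ _ P (fun t => a < t) (fun t => a + 1 < t)) => // t; lra.
- by apply/(@lower_shift _ _ P (fun t => a + 1 < t) (fun t => a + 1 + 1 < t)) => // t; lra.
- by apply/(@upper_shift _ _ P (fun t => a < t) (fun t => a + 1 < t)) => // t; lra.
- by apply/(@lower_shift _ _ P (fun t => a + 1 < t) (fun t => a + 1 + 1 < t)) => // t; lra.
Qed.

(** The shift negates classes, which the signs of [p'] and [q] compensate, and [phi - a] is
    unchanged. *)
Lemma heart_slice_shift (p' q : 'cV[R]_m) a phi E :
  heart_slice P cl (- p') (- q) (a + 1) (phi + 1) (shift E) <-> heart_slice P cl p' q a phi E.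
Proof.
have ee : phi + 1 - (a + 1) = phi - a by ring.
split=> -[h [iE [r [r0 xE yE]] sub]]; split; try lra; split.
- exact/in_heart_shift.
- by exists r; rewrite -(ev_shift p') -(ev_shift q) -ee.
- move=> A B iA iB /tri_shift t.
  move/in_heart_shift: iA => iA; move/in_heart_shift: iB => iB.
  by have := sub _ _ iA iB t; rewrite /crossE !ev_shift ee.
- exact/in_heart_shift.
- by exists r; rewrite (ev_shift p') (ev_shift q) ee.
- move=> A B iA iB t; have [A' iA'] := shift_es A; have [B' iB'] := shift_es B.
  have t' : tri A' E B' by apply/tri_shift; apply: tri_iso t => //; exact: iso_refl.
  have jA : in_heart P a A' by apply/in_heart_shift; exact: in_heart_iso iA' iA.
  have jB : in_heart P a B' by apply/in_heart_shift; exact: in_heart_iso iB' iB.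
  by have := sub _ _ jA jB t'; rewrite /crossE ee !(L_iso R cl_tri iA') !ev_shift.
Qed.

End HeartShift.

Section NewSlicing.
Variables (R : realType) (D : triangulated) (P : slicing R D) (m : nat).
Variable cl : D -> 'rV[int]_m.
Hypothesis cl_tri : forall A B C, tri A B C -> cl B = cl A + cl C.
Variables (Q : 'rV[R]_m -> R) (p p' q : 'cV[R]_m) (theta c eta e : R).
Hypothesis hQ : is_quadratic_form Q.

Let L E := latR R (cl E).

Hypothesis hZ : forall phi E, semistable P phi E -> exists r,
  [/\ 0 < r, ev p (L E) = r * cos (pi * (phi - theta)) & ev q (L E) = r * sin (pi * (phi - theta))].
Hypothesis hQs : forall phi E, semistable P phi E -> 0 <= Q (L E).
Hypothesis c0 : 0 < c.
Hypothesis hc : forall t z, 0 <= t <= 1 -> 0 <= Q z ->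
  c * l1norm z <= `|ev (p + t *: (p' - p)) z| + `|ev q z|.
Hypothesis hd : forall z, 0 <= Q z ->
  `|ev p' z - ev p z| <= eta / 2 * (`|ev p z| + `|ev q z|).
Hypothesis he : 0 < e <= 2^-1.
Hypothesis eta0 : 0 <= eta.
Hypothesis eta_e : eta < sin (pi * e).

Section OneHeart.
Variable k : int.
Let s := parity R k.
Let a := theta + k%:~R.

Lemma heart_hZ phi E : semistable P phi E -> exists r, [/\ 0 < r,
  ev (s *: p) (L E) = r * cos (pi * (phi - a)) & ev (s *: q) (L E) = r * sin (pi * (phi - a))].
Proof.
move=> sE; have [r [r0 xE yE]] := hZ sE; exists r.
have -> : phi - a = phi - theta - k%:~R by rewrite /a; ring.
by rewrite !ev_scalel xE yE cos_parity sin_parity; split=> //; rewrite mulrCA.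
Qed.

Lemma heart_hc t z : 0 <= t <= 1 -> 0 <= Q z ->
  c * l1norm z <= `|ev (s *: p + t *: (s *: p' - s *: p)) z| + `|ev (s *: q) z|.
Proof.
move=> t01 Qz; have -> : s *: p + t *: (s *: p' - s *: p) = s *: (p + t *: (p' - p)).
  by rewrite -scalerBr scalerA (mulrC t) -scalerA -scalerDr.
by rewrite !ev_scalel !normrM parity_norm !mul1r; exact: hc.
Qed.

Lemma heart_hd z : 0 <= Q z -> `|ev (s *: p') z - ev (s *: p) z| <=
  eta / 2 * (`|ev (s *: p) z| + `|ev (s *: q) z|).
Proof.
by move=> Qz; rewrite !ev_scalel -mulrBr !normrM parity_norm !mul1r; exact: hd.
Qed.

End OneHeart.

(** The sign [(-1)^k] rotates the charge on the [k]-th heart into the upper half plane, so the same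
    construction serves all hearts. *)
Definition new_slice phi E := exists k : int,
  heart_slice P cl (parity R k *: p') (parity R k *: q) (theta + k%:~R) phi E.

Lemma new_slice_zero phi E : is_zero E -> new_slice phi E.
Proof.
move=> z; have [k hk] := int_interval theta phi; exists k; split=> //.
exact: deformed_zero.
Qed.

Lemma new_slice_iso phi E F : isomorphic E F -> new_slice phi E -> new_slice phi F.
Proof. by move=> i [k [hk dE]]; exists k; split=> //; exact: (deformed_iso cl_tri i dE). Qed.

Lemma new_slice_shift phi E :
  new_slice (phi + 1) E <-> exists F, new_slice phi F /\ isomorphic E (shift F).
Proof.
split=> [[k h]|[F [[k h] i]]].
  have [F i] := shift_es E; exists F; split=> //.
  exists (k - 1); apply/(heart_slice_shift _ cl_tri).
  rewrite -!scaleNr -!parityS subrK (_ : theta + (k - 1)%:~R + 1 = theta + k%:~R); last first.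
    by rewrite intrD intrN; ring.
  by case: h => hk dE; split=> //; exact: (deformed_iso cl_tri i dE).
apply: new_slice_iso (iso_sym i) _; exists (k + 1).
rewrite parityS !scaleNr intrD addrA.
exact/heart_slice_shift.
Qed.

(** Within one heart this is [deformed_hom0]; between different hearts it is orthogonality for the
    old slicing, whose hearts are unchanged. *)
Lemma new_slice_hom0 phi1 phi2 E1 E2 : phi2 < phi1 ->
  new_slice phi1 E1 -> new_slice phi2 E2 -> forall f : hom E1 E2, f = 0.
Proof.
move=> h12 [k1 [/andP[h1 h1'] d1]] [k2 [/andP[h2 h2'] d2]].
have k21 : (k2 < k1 + 1)%R by rewrite -(ltr_int R) intrD; lra.
move: k21; rewrite ltzD1 le_eqVlt => /orP[/eqP e12|k21].
  move: h2 h2' d2; rewrite e12 => h2 h2' d2.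
  exact: (deformed_hom0 cl_tri (heart_hZ k1) hQs (@heart_hd k1) eta0 eta_e h2 h12 h1' d1 d2).
have {}k21 : k2%:~R + 1 <= k1%:~R :> R by move: k21; rewrite -lezD1 -(ler_int R) intrD.
have [[u1 _] _ _] := d1; have [[_ l2] _ _] := d2.
by apply: (upper_lower_hom0 _ u1) => //; apply: lowerW l2 => t; lra.
Qed.

Lemma hn_mono (S S' : R -> D -> Prop) s E : (forall phi F, S phi F -> S' phi F) ->
  hn S s E -> hn S' s E.
Proof.
move=> SS'; elim=> {s E} [E z|s phi A E F _ IH t SF nF ls]; first exact: hn_nil.
by apply: hn_cons IH t _ nF ls; exact: SS'.
Qed.

(** Every object has phases in a finite union of consecutive hearts. Truncation removes the top
    heart first, and the filtrations of the pieces concatenate because new phases stay inside their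
    heart. *)
Lemma new_slice_hn E : exists s, hn new_slice s E.
Proof.
have main (n : nat) (j : int) F : upper P (fun t => theta + j%:~R < t) F ->
    lower P (fun t => theta + j%:~R + n%:R < t) F ->
    exists2 s, hn new_slice s F & forall t, t \in s -> t <= theta + j%:~R + n%:R.
  elim: n F => [|n IH] F uF lF.
    exists [::] => //; apply: hn_nil; apply: (upper_lower_zero _ uF) => //.
    by apply: lowerW lF => t; rewrite addr0.
  set b := theta + j%:~R + n%:R.
  have bE : b = theta + (j + n%:Z)%:~R by rewrite /b intrD; ring.
  have bS : theta + j%:~R + n.+1%:R = b + 1 by rewrite /b -natr1; ring.
  rewrite bS in lF *.
  have n0 : 0 <= n%:R :> R by exact: ler0n.
  have [T [F' [uT lF' t]]] := truncation P F (@up_closed_gt R b).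
  have lT : lower P (fun t => b + 1 < t) T by apply: lower_sub t lF lF' _ => u; lra.
  have uF' : upper P (fun t => theta + j%:~R < t) F'.
    by apply: upper_quot t uF uT _ => u; rewrite /b; lra.
  have [s hs ss] := IH _ uF' lF'.
  have iT : in_heart P (theta + (j + n%:Z)%:~R) T by rewrite -bE.
  have [s' hs' ss'] := hn_heart cl_tri (heart_hZ (j + n%:Z)) hQs c0
    (@heart_hc (j + n%:Z)) (@heart_hd (j + n%:Z)) eta0 eta_e iT.
  rewrite -bE in ss'.
  exists (s ++ s').
    apply: hn_cat hs _ t _.
      by apply: hn_mono hs' => phi G HG; exists (j + n%:Z).
    by move=> u v /ss hu /ss' /andP[hv _]; exact: le_lt_trans hu hv.
  move=> u; rewrite mem_cat => /orP[/ss|/ss']; rewrite -/b; lra.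
have [M [M0 HM]] := bounds_ex P E.
have [j hj] : exists j : nat, M + `|theta| < j%:R.
  by exists (Num.truncn (M + `|theta|)).+1; exact: truncnS_gt.
have n1 := ler_norm theta; have n2 := ler_norm (- theta); rewrite normrN in n2.
have [|u l] := HM (- theta + j%:R); first lra.
have [|u' l'] := HM (theta + j%:R); first lra.
have [|| s hs _] := main (j + j)%N (- j%:Z) E.
- by apply: upperW u => t; rewrite mulrNz; lra.
- by apply: lowerW l' => t; rewrite mulrNz natrD; lra.
- by exists s.
Qed.

Lemma new_slicing : exists P' : slicing R D,
  [/\ forall phi E, semistable P' phi E -> exists r, [/\ 0 < r,
        ev p' (L E) = r * cos (pi * (phi - theta)) & ev q (L E) = r * sin (pi * (phi - theta))],
      forall phi E, semistable P' phi E -> 0 <= Q (L E)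
    & (slicing_dist P P' <= e%:E)%E].
Proof.
have HN E : inhabited (HN_filtration new_slice E).
  by have [s /filtration_of_hn[H _]] := new_slice_hn E; constructor.
exists (Slicing new_slice_zero new_slice_iso new_slice_shift new_slice_hom0 HN).
split=> [phi E [[k [hk dE]] nE]|phi E [[k h] nE]|].
- have [iE [r [r0 xE yE]] _] := dE; exists r.
  have [_ xy] := heart_charge cl_tri (heart_hZ k) hQs (@heart_hd k) eta0 eta_e iE nE.
  (* [deformed] admits [r = 0] for the sake of zero objects; for a nonzero one, [y = 0] forces
     [x' < 0]. *)
  have rn : r != 0.
    by apply/eqP => re; move: xy; rewrite xE yE re !mul0r ltxx => /(_ erefl).
  have ee : phi - (theta + k%:~R) = phi - theta - k%:~R by ring.
  have K u v : ev (parity R k *: u) (L E) = r * (parity R k * v) -> ev u (L E) = r * v.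
    rewrite ev_scalel => h; rewrite -(mul1r (ev u _)) -(parity_sqr R k) -mulrA h.
    by rewrite mulrCA (mulrA (parity R k)) parity_sqr mul1r.
  split; first by rewrite lt_neqAle eq_sym rn.
    by apply: K; rewrite xE ee cos_parity.
  by apply: K; rewrite yE ee sin_parity.
- exact: (deformed_support cl_tri hQ (heart_hZ k) hQs c0
    (@heart_hc k) (@heart_hd k) eta0 eta_e h nE).
- have /andP[e0 _] := he.
  apply: slicing_dist_le => [|phi E [k h]]; first exact: ltW.
  exact: (deformed_bounds cl_tri (heart_hZ k) hQs (@heart_hd k) he eta0 eta_e h).
Qed.

End NewSlicing.

(** * Deformation and uniqueness of stability conditions *)

Section Charges.
Variables (R : realType) (m : nat).
Implicit Types (Z W : 'cV[R[i]]_m) (x : 'rV[R]_m) (a : R).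

Definition mxRe Z : 'cV[R]_m := \col_i complex.Re (Z i 0).
Definition mxIm Z : 'cV[R]_m := \col_i complex.Im (Z i 0).

Lemma ReD (z w : R[i]) : complex.Re (z + w) = complex.Re z + complex.Re w.
Proof. by case: z => ? ?; case: w. Qed.

Lemma ImD (z w : R[i]) : complex.Im (z + w) = complex.Im z + complex.Im w.
Proof. by case: z => ? ?; case: w. Qed.

Lemma Re_charge Z x : complex.Re (charge_lin Z x) = ev (mxRe Z) x.
Proof.
rewrite /charge_lin /ev !mxE (big_morph _ ReD (erefl _)); apply: eq_bigr => i _.
by rewrite !mxE; case: (Z i 0) => u w /=; rewrite mul0r subr0.
Qed.

Lemma Im_charge Z x : complex.Im (charge_lin Z x) = ev (mxIm Z) x.
Proof.
rewrite /charge_lin /ev !mxE (big_morph _ ImD (erefl _)); apply: eq_bigr => i _.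
by rewrite !mxE; case: (Z i 0) => u w /=; rewrite mul0r addr0.
Qed.

(* The real and imaginary parts of [e^(- i pi a) Z]. *)
Definition rotRe a Z := cos (pi * a) *: mxRe Z + sin (pi * a) *: mxIm Z.
Definition rotIm a Z := cos (pi * a) *: mxIm Z - sin (pi * a) *: mxRe Z.

Lemma neg_def_on_kerE (Q : 'rV[R]_m -> R) Z : neg_def_on_ker Q Z <->
  forall x, ev (mxRe Z) x = 0 -> ev (mxIm Z) x = 0 -> x != 0 -> Q x < 0.
Proof.
split=> H x; last by move=> h; apply: H; rewrite -?Re_charge -?Im_charge h.
move=> h1 h2; apply: H; apply/eqP; rewrite eq_complex Re_charge Im_charge h1 h2 !eqxx //.
Qed.

Definition charge_close (d : R) Z W := forall i,
  `|mxRe W i 0 - mxRe Z i 0| <= d /\ `|mxIm W i 0 - mxIm Z i 0| <= d.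

Lemma close_bound d (p q : 'cV[R]_m) x : (forall i, `|p i 0 - q i 0| <= d) ->
  `|ev p x - ev q x| <= d * l1norm x.
Proof.
move=> H; rewrite -ev_oppl -ev_addl; apply: ev_bound => i.
by rewrite !mxE.
Qed.

Variable Q : 'rV[R]_m -> R.
Hypothesis hQ : is_quadratic_form Q.

Lemma close_constants Z0 eta : neg_def_on_ker Q Z0 -> 0 < eta ->
  exists c d, [/\ 0 < c, 0 < d,
    forall p q : 'cV[R]_m, (forall i, `|p i 0 - mxRe Z0 i 0| <= d) ->
      (forall i, `|q i 0 - mxIm Z0 i 0| <= d) ->
      forall x, 0 <= Q x -> c * l1norm x <= `|ev p x| + `|ev q x| &
    2 * d <= eta * c].
Proof.
move=> /neg_def_on_kerE neg eta0.
have [c c0 Hc] := support_constant hQ neg.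
(* A change of [c / 4] in each part costs at most half of the constant [c]; the second bound is the
   last conclusion for [c / 2]. *)
pose d := Num.min (c / 4) (eta * (c / 2) / 2).
have d1 : d <= c / 4 by rewrite ge_min lexx.
have d2 : d <= eta * (c / 2) / 2 by rewrite ge_min lexx orbT.
exists (c / 2), d; split; first by rewrite divr_gt0.
- by rewrite lt_min !divr_gt0 // mulr_gt0 // divr_gt0.
- move=> p q Hp Hq x Qx; have := Hc _ Qx.
  have := close_bound x Hp; have := close_bound x Hq.
  have := ler_wpM2r (l1norm_ge0 x) d1 => /= h0 h1 h2 h3.
  have h5 : `|ev (mxRe Z0) x| <= `|ev p x| + `|ev p x - ev (mxRe Z0) x|.
    by rewrite distrC -{1}(subrK (ev p x) (ev (mxRe Z0) x)) addrC ler_normD.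
  have h6 : `|ev (mxIm Z0) x| <= `|ev q x| + `|ev q x - ev (mxIm Z0) x|.
    by rewrite distrC -{1}(subrK (ev q x) (ev (mxIm Z0) x)) addrC ler_normD.
  lra.
- lra.
Qed.

End Charges.

Section Deformation.
Variables (R : realType) (D : triangulated) (m : nat).
Variable v : {additive Kgroup D -> 'rV[int]_m}.
Implicit Types (Z W : 'cV[R[i]]_m) (P : slicing R D).

Definition cls (E : D) : 'rV[int]_m := v (Kcls E).
Let L E := latR R (cls E).

Lemma cls_tri (A B C : D) : tri A B C -> cls B = cls A + cls C.
Proof. by move=> [f [g [h /Kcls_dist e]]]; rewrite /cls e raddfD. Qed.

Lemma chargeE Z E : charge v Z E = charge_lin Z (L E).
Proof.
rewrite /charge /charge_lin; congr ((_ *m _) 0 0).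
by apply/matrixP => i j; rewrite !mxE rmorph_int.
Qed.

Definition polar_at a (p q : 'cV[R]_m) P := forall phi E, semistable P phi E -> exists r,
  [/\ 0 < r, ev p (L E) = r * cos (pi * (phi - a)) & ev q (L E) = r * sin (pi * (phi - a))].

Lemma prestability_polar a Z P : prestability v Z P <-> polar_at a (rotRe a Z) (rotIm a Z) P.
Proof.
have eR E : ev (rotRe a Z) (L E) =
    cos (pi * a) * complex.Re (charge v Z E) + sin (pi * a) * complex.Im (charge v Z E).
  by rewrite ev_addl !ev_scalel chargeE Re_charge Im_charge.
have eI E : ev (rotIm a Z) (L E) =
    cos (pi * a) * complex.Im (charge v Z E) - sin (pi * a) * complex.Re (charge v Z E).
  by rewrite ev_addl ev_oppl !ev_scalel chargeE Re_charge Im_charge.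
split=> H phi E sE; have := H phi E sE.
  move=> [r r0 e]; exists r; split=> //.
    by rewrite eR e /= mulrBr cosB; ring.
  by rewrite eI e /= mulrBr sinB; ring.
move=> [r [r0]]; rewrite eR eI; set u := complex.Re _; set w := complex.Im _ => h1 h2.
exists r => //; apply/eqP; rewrite eq_complex -/u -/w /=.
have cs := cos2Dsin2 (pi * a).
have eu : u = cos (pi * a) * (cos (pi * a) * u + sin (pi * a) * w)
    - sin (pi * a) * (cos (pi * a) * w - sin (pi * a) * u).
  by rewrite -[LHS]mul1r -cs; ring.
have ew : w = sin (pi * a) * (cos (pi * a) * u + sin (pi * a) * w)
    + cos (pi * a) * (cos (pi * a) * w - sin (pi * a) * u).
  by rewrite -[LHS]mul1r -cs; ring.
have e : pi * phi = pi * (phi - a) + pi * a by ring.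
rewrite h1 h2 in eu ew.
by rewrite eu ew e cosD sinD; apply/andP; split; apply/eqP; ring.
Qed.

Definition positive_on (Q : 'rV[R]_m -> R) P :=
  forall phi E, semistable P phi E -> 0 <= Q (L E).

Variable Q : 'rV[R]_m -> R.
Hypothesis hQ : is_quadratic_form Q.

(** The rotation by [a] selects the part that moves: the real part for [a = 0], the imaginary part
    for [a = 1/2]. *)
Lemma deform_at a Z W P c d eta e : 0 < e <= 2^-1 -> 0 <= eta -> eta < sin (pi * e) ->
  rotIm a W = rotIm a Z -> 0 < c ->
  (forall t z, 0 <= t <= 1 -> 0 <= Q z -> c * l1norm z <=
     `|ev (rotRe a Z + t *: (rotRe a W - rotRe a Z)) z| + `|ev (rotIm a Z) z|) ->
  (forall i, `|rotRe a W i 0 - rotRe a Z i 0| <= d) -> d <= eta / 2 * c ->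
  prestability v Z P -> positive_on Q P ->
  exists P', [/\ prestability v W P', positive_on Q P' & (slicing_dist P P' <= e%:E)%E].
Proof.
move=> he eta0 eta_e eI c0 hc hd dc /(prestability_polar a) hZ hQs.
have hd' z : 0 <= Q z -> `|ev (rotRe a W) z - ev (rotRe a Z) z| <=
    eta / 2 * (`|ev (rotRe a Z) z| + `|ev (rotIm a Z) z|).
  move=> Qz; apply: le_trans (close_bound z hd) _.
  apply: (@le_trans _ _ (eta / 2 * (c * l1norm z))).
    by rewrite mulrA; apply: ler_wpM2r => //; exact: l1norm_ge0.
  apply: ler_wpM2l; first by rewrite divr_ge0.
  have t01 : 0 <= (0 : R) <= 1 by rewrite lexx ler01.
  by have := hc _ _ t01 Qz; rewrite scale0r addr0.
have [P' [h1 h2 h3]] := new_slicing cls_tri hQ hZ hQs c0 hc hd' he eta0 eta_e.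
exists P'; split=> //; apply/(prestability_polar a) => phi E sE.
by have [r [? ? ?]] := h1 _ _ sE; exists r; rewrite eI.
Qed.

Lemma rotRe0 Z : rotRe 0 Z = mxRe Z.
Proof. by rewrite /rotRe mulr0 cos0 sin0 scale1r scale0r addr0. Qed.
Lemma rotIm0 Z : rotIm 0 Z = mxIm Z.
Proof. by rewrite /rotIm mulr0 cos0 sin0 scale1r scale0r subr0. Qed.
Lemma rotRe_half Z : rotRe 2^-1 Z = mxIm Z.
Proof. by rewrite /rotRe cos_pihalf sin_pihalf scale1r scale0r add0r. Qed.
Lemma rotIm_half Z : rotIm 2^-1 Z = - mxRe Z.
Proof. by rewrite /rotIm cos_pihalf sin_pihalf scale1r scale0r sub0r. Qed.

Lemma segment_close (d t a b c : R) : 0 <= t <= 1 -> `|a - c| <= d -> `|b - c| <= d ->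
  `|a + t * (b - a) - c| <= d.
Proof.
move=> /andP[t0 t1]; rewrite !ler_norml => /andP[h1 h2] /andP[h3 h4].
have t1' : 0 <= 1 - t by lra.
have := ler_wpM2l t1' h1; have := ler_wpM2l t1' h2.
have := ler_wpM2l t0 h3; have := ler_wpM2l t0 h4 => /= *.
by apply/andP; split; lra.
Qed.

Lemma deform Z0 e : neg_def_on_ker Q Z0 -> 0 < e -> exists2 d, 0 < d &
  forall Z, charge_close d Z0 Z -> neg_def_on_ker Q Z /\
    forall W P, charge_close d Z0 W -> prestability v Z P -> positive_on Q P ->
    exists P', [/\ prestability v W P', positive_on Q P' & slicing_ball P e P'].
Proof.
move=> neg e0; pose e' := Num.min 2^-1 (e / 4).
(* Each of the two moves costs at most [e' <= e / 4], hence strictly less than [e / 2]. *)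
have he : 0 < e' <= 2^-1.
  by rewrite lt_min ge_min lexx invr_gt0 ltr0n divr_gt0.
have e'e : e' <= e / 4 by rewrite ge_min lexx orbT.
pose eta := sin (pi * e') / 2.
have se : 0 < sin (pi * e') by apply: sinpi_gt0; move: he; lra.
have eta0 : 0 < eta by rewrite divr_gt0.
have eta_e : eta < sin (pi * e') by rewrite /eta; lra.
(* Two charges of the box differ by up to [2 d], and [deform_at] asks for [2 d <= eta / 2 * c]. *)
have eta4 : 0 < eta / 2 by rewrite divr_gt0.
have [c [d [c0 d0 Hc dc]]] := close_constants hQ neg eta4.
exists d => // Z cZ; split.
  apply/neg_def_on_kerE => x x1 x2 xn; rewrite ltNge; apply/negP => Qx.
  have := Hc _ _ (fun i => (cZ i).1) (fun i => (cZ i).2) _ Qx.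
  by rewrite x1 x2 normr0 addr0 pmulr_rle0 // => /l1norm_eq0 /eqP; rewrite (negPf xn).
move=> W P cW pZ PQ.
(* The intermediate charge has the real part of [W] and the imaginary part of [Z]. *)
pose M : 'cV[R[i]]_m := \col_i (mxRe W i 0 +i* mxIm Z i 0)%C.
have MR : mxRe M = mxRe W by apply/colP => i; rewrite !mxE.
have MI : mxIm M = mxIm Z by apply/colP => i; rewrite !mxE.
have tri_close (p q r : R) : `|p - r| <= d -> `|q - r| <= d -> `|p - q| <= 2 * d.
  by rewrite !ler_norml; lra.
have [|||||||P1 [p1 q1 d1]] := @deform_at 0 Z M P c (2 * d) eta e' he (ltW eta0) eta_e.
- by rewrite !rotIm0.
- by [].
- rewrite !rotIm0 !rotRe0 MR => t z t01 Qz.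
  apply: Hc Qz => i; last exact: (cZ i).2.
  by rewrite !mxE; have := segment_close t01 (cZ i).1 (cW i).1; rewrite !mxE.
- by move=> i; rewrite !rotRe0 MR; exact: tri_close (cW i).1 (cZ i).1.
- by move: dc; lra.
- by [].
- by [].
have [|||||||P2 [p2 q2 d2]] := @deform_at 2^-1 M W P1 c (2 * d) eta e' he (ltW eta0) eta_e.
- by rewrite !rotIm_half MR.
- by [].
- rewrite !rotIm_half !rotRe_half MR MI => t z t01 Qz.
  rewrite ev_oppl normrN addrC; apply: Hc Qz => i; first exact: (cW i).1.
  by rewrite !mxE; have := segment_close t01 (cZ i).2 (cW i).2; rewrite !mxE.
- by move=> i; rewrite !rotRe_half MI; exact: tri_close (cW i).2 (cZ i).2.
- by move: dc; lra.
- by [].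
- by [].
exists P2; split=> //.
have lt : (e'%:E < (e / 2)%:E :> \bar R)%E by rewrite lte_fin; lra.
rewrite (_ : e = e / 2 + e / 2); last by lra.
apply: (@slicing_ball_triangle _ _ P P1 P2); rewrite /slicing_ball /=; [exact: le_lt_trans d1 lt|exact: le_lt_trans d2 lt].
Qed.

Lemma slicing_ext P P' : (forall phi E, P phi E <-> P' phi E) -> P = P'.
Proof.
case: P => s1 a1 a2 a3 a4 a5; case: P' => s2 b1 b2 b3 b4 b5 /= h.
have e : s1 = s2 by apply/funext => phi; apply/funext => E; apply/propext.
by subst s2; congr Slicing; exact: Prop_irrelevance.
Qed.

(* If the part [A] of [E] of [P']-phases greater than [phi] were nonzero, then
   [Im (e^(- i pi phi) Z A) > 0]; but all [P]-phases of [A] lie in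
   [(phi - 1, phi]]. *)
Lemma slice_unique Z P P' phi E : prestability v Z P -> prestability v Z P' ->
  slicing_ball P 1 P' -> P phi E -> P' phi E.
Proof.
move=> hP hP' d PE; have [z|nE] := pselect (is_zero E); first exact: slice_zero.
have d' := slicing_ball_sym d.
have hZ a := (prestability_polar a Z P).1 hP; have hZ' a := (prestability_polar a Z P').1 hP'.
have uE : upper P (fun t => phi <= t) E by exact: slice_upper PE _.
have lE : lower P (fun t => phi < t) E.
  by apply: slice_lower PE _ => //; rewrite ltxx.
have [A [B [uA lB t]]] := truncation P' E (@up_closed_gt R phi).
have lA' : lower P' (fun t => phi + 1 <= t) A.
  apply: lower_sub t ((slicing_dist_lt E d).1 _ lE) lB _ => u; lra.
have lB' : lower P (fun t => phi + 1 <= t) B.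
  have := (slicing_dist_lt B d').1 (phi) lB; exact.
have lA : lower P (fun t => phi < t) A by apply: lower_sub t lE lB' _ => u; lra.
have uE' := (slicing_dist_lt E d).2 _ uE.
have sgn E' : ev (rotIm phi Z) (L E') = - ev (rotIm (phi - 1) Z) (L E').
  have -> : rotIm (phi - 1) Z = - rotIm phi Z; last by rewrite ev_oppl opprK.
  have -> : phi = phi - 1 + 1 by ring.
  rewrite /rotIm [in RHS](mulrDr _ (phi - 1)) mulr1 cosDpi sinDpi addrK.
  by rewrite !scaleNr opprB opprK addrC.
have [zA|nA] := pselect (is_zero A).
  (* Now [E] has [P']-phases in [(phi - 1, phi]], and its charge lies on the boundary ray of phase
     [phi]; [y_eq0] places it in [P' phi]. *)
  have iE := tri_zero1 t zA.
  have iB : in_heart P' (phi - 1) B.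
    split; first by apply: upper_iso iE _; apply: upperW uE' => u; lra.
    by apply: lowerW lB => u; rewrite subrK.
  have [r [_ _ yE]] := hZ phi _ _ (conj PE nE).
  have := y_eq0 cls_tri (hZ' (phi - 1)) iB; rewrite subrK => H.
  apply: slice_iso (iso_sym iE) _; apply: H.
  rewrite -(L_iso R cls_tri iE) -[LHS]opprK -sgn yE subrr mulr0 sin0 mulr0 oppr0 //.
have iA : in_heart P (phi - 1) A.
  split; last by rewrite subrK.
  by apply: (slicing_dist_lt A d').2; apply: upperW uA => u; exact: ltW.
have iA' : in_heart P' phi A.
  by split=> //; apply: lowerW lA' => u; exact: ltW.
have h1 := below_top_y cls_tri (hZ' phi) iA' lA' nA.
have := y_ge0 cls_tri (hZ (phi - 1)) iA.
by move: h1; rewrite sgn; lra.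
Qed.

Lemma slicing_unique Z P P' : prestability v Z P -> prestability v Z P' ->
  slicing_ball P 1 P' -> P = P'.
Proof.
move=> hP hP' d; apply: slicing_ext => phi E; split; first exact: (slice_unique hP hP' d).
exact: (slice_unique hP' hP (slicing_ball_sym d)).
Qed.

End Deformation.

(** * The topology of the space of stability conditions *)

Section Topology.
Variables (R : realType) (D : triangulated) (m : nat).
Variable v : {additive Kgroup D -> 'rV[int]_m}.
Local Notation stab := (stab R v).
Implicit Types (Z : 'cV[R[i]]_m) (P : slicing R D) (s t : stab).

Lemma nbhs_close Z d : 0 < d -> nbhs Z (charge_close d Z).
Proof.
move=> d0; have d0' : 0 < (d%:C)%C by rewrite ltcR.
exists (fun i j => [set z : R[i] | `|z - Z i j| < (d%:C)%C]).
  move=> i j; apply/nbhs_ballP; exists (d%:C)%C => //= z.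
  by rewrite /ball /= distrC.
move=> W HW i; have := HW i 0; rewrite /= !mxE; move: (W i 0) (Z i 0) => [a b] [a' b'].
rewrite normc_def ltcR /= => h.
have H u w : Num.sqrt (u ^+ 2 + w ^+ 2) < d -> `|u| <= d.
  move=> h'; apply: ltW; apply: le_lt_trans h'.
  by rewrite -sqrtr_sqr ler_wsqrtr // lerDl sqr_ge0.
by split; [exact: H h|apply: (H _ (a - a')); rewrite addrC].
Qed.

Lemma open_slicing_ball P e : open (slicing_ball P e).
Proof.
rewrite openE => P' /=; rewrite /slicing_ball /= => d.
have d0 : (0 <= slicing_dist P P')%E by apply: ereal_sup_ubound; left.
case E : (slicing_dist P P') d d0 => [r| |] //; rewrite lte_fin lee_fin => re r0.
(* Half of the slack keeps [P'] strictly inside the ball of the remaining radius, as the triangle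
   inequality for open balls requires. *)
have e0 : 0 < (e - r) / 2 by rewrite divr_gt0 // subr_gt0.
apply/nbhs_ballP; exists ((e - r) / 2) => //= P'' d'.
have -> : e = (e - (e - r) / 2) + (e - r) / 2 by ring.
apply: slicing_ball_triangle d'.
by rewrite /slicing_ball /= E lte_fin; lra.
Qed.

Definition stab_pair s := (stab_charge s, stab_slicing s).

Lemma stab_pair_continuous : continuous stab_pair.
Proof. exact: initial_continuous. Qed.

Lemma stab_charge_continuous : continuous (@stab_charge R D m v).
Proof.
move=> s; apply: (@continuous_comp _ _ _ stab_pair fst); first exact: stab_pair_continuous.
exact: cvg_fst.
Qed.

Lemma stab_slicing_continuous : continuous (@stab_slicing R D m v).
Proof.
move=> s; apply: (@continuous_comp _ _ _ stab_pair snd); first exact: stab_pair_continuous.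
exact: cvg_snd.
Qed.

Lemma nbhs_stab s (A : set stab) : nbhs s A -> exists B e,
  [/\ nbhs (stab_charge s) B, 0 < e & forall t, B (stab_charge t) ->
    slicing_ball (stab_slicing s) e (stab_slicing t) -> A t].
Proof.
rewrite nbhsE => -[O [[V oV <-] Os] OA].
have : nbhs (stab_pair s) V by apply: open_nbhs_nbhs.
move=> [[B C] /= [nB /nbhs_ballP[e e0 eC]] BC].
exists B, e; split=> // t Bt dt; apply: OA; apply: BC; split=> //=.
exact: eC.
Qed.

Lemma stab_ext s t : stab_charge s = stab_charge t -> stab_slicing s = stab_slicing t -> s = t.
Proof.
case: s => Z P a b; case: t => Z' P' a' b' /= e1 e2; subst Z' P'.
by congr Stab; exact: Prop_irrelevance.
Qed.

Lemma stab_unique s t : stab_charge s = stab_charge t ->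
  slicing_ball (stab_slicing s) 1 (stab_slicing t) -> s = t.
Proof.
move=> e d; apply: stab_ext => //.
have pt : prestability v (stab_charge s) (stab_slicing t) by rewrite e; exact: stab_pre.
exact: slicing_unique (@stab_pre _ _ _ _ s) pt d.
Qed.

Lemma slicing_ballW P P' e e' : e <= e' -> slicing_ball P e P' -> slicing_ball P e' P'.
Proof. by move=> ee h; apply: lt_le_trans h _; rewrite lee_fin. Qed.

Variable Q : 'rV[R]_m -> R.
Hypothesis hQ : is_quadratic_form Q.

Definition supported : set stab :=
  [set s | support_property v Q (stab_charge s) (stab_slicing s)].

Lemma deform_stab Z0 e : neg_def_on_ker Q Z0 -> 0 < e -> exists2 d, 0 < d &
  forall Z, charge_close d Z0 Z -> neg_def_on_ker Q Z /\
    forall s W, charge_close d Z0 W -> supported s -> stab_charge s = Z ->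
    exists t, [/\ stab_charge t = W, supported t & slicing_ball (stab_slicing s) e (stab_slicing t)].
Proof.
move=> neg e0; have [d d0 H] := deform v hQ neg e0; exists d => // Z cZ.
have [nZ HZ] := H _ cZ; split=> // s W cW [_ ss] sZ.
have pZ : prestability v Z (stab_slicing s) by rewrite -sZ; exact: stab_pre.
have [P' [pP qP bP]] := HZ W _ cW pZ ss.
have sup : support_property v Q W P' by split=> //; exact: (H _ cW).1.
by exists (Stab pP (ex_intro _ Q (conj hQ sup))).
Qed.

Lemma close_refl d Z : 0 <= d -> charge_close d Z Z.
Proof. by move=> d0 i; rewrite !subrr normr0. Qed.

(** For [t] near [s], deforming [s] to the charge of [t] gives a supported [u] within [1/2] of [s].
    Since [t] is within [1/2] of [s] as well, uniqueness identifies [t] with [u]. *)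
Lemma open_supported : open supported.
Proof.
rewrite openE => s ss; have e0 : 0 < (2^-1 : R) by lra.
have [d d0 H] := deform_stab ss.1 e0.
have h1 : nbhs s (@stab_charge R D m v @^-1` charge_close d (stab_charge s)).
  by apply: stab_charge_continuous; exact: nbhs_close.
have h2 : nbhs s (@stab_slicing R D m v @^-1` slicing_ball (stab_slicing s) 2^-1).
  by apply: stab_slicing_continuous; apply/nbhs_ballP; exists 2^-1.
have FF : Filter (nbhs s) by exact: nbhs_filter.
apply: (@filterS _ (nbhs s) FF _ _ _ (@filterI _ (nbhs s) FF _ _ h1 h2)) => t [/= ct bt].
have [u [uZ su bu]] := (H _ (close_refl (stab_charge s) (ltW d0))).2 s _ ct ss erefl.
rewrite (_ : t = u) //; apply/esym/stab_unique => //.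
rewrite (_ : 1 = 2^-1 + 2^-1 :> R); last by lra.
exact: slicing_ball_triangle (slicing_ball_sym bu) bt.
Qed.

(** * Sheets over a small box of charges *)

Section Sheet.
Variables (Z0 : 'cV[R[i]]_m) (d : R).
Hypothesis d0 : 0 < d.
Hypothesis neg : neg_def_on_ker Q Z0.
Hypothesis Hd : forall Z, charge_close d Z0 Z -> neg_def_on_ker Q Z /\
    forall s W, charge_close d Z0 W -> supported s -> stab_charge s = Z ->
    exists t, [/\ stab_charge t = W, supported t & slicing_ball (stab_slicing s) 3^-1 (stab_slicing t)].

Let O := (charge_close d Z0)^°.
Let base := [set Z' | neg_def_on_ker Q Z'] `&` O.

Let O_close Z : O Z -> charge_close d Z0 Z.
Proof. exact: interior_subset. Qed.

(** Two points within [1/3] of [s] are at distance below [2/3 < 1], so equal charges make them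
    equal. *)
Let sheet_nbhs s : set stab :=
  (@stab_charge R D m v @^-1` O) `&`
  (@stab_slicing R D m v @^-1` slicing_ball (stab_slicing s) 3^-1).
Definition sheet s : set stab := supported `&` sheet_nbhs s.

Lemma sheet_unique s t t' : sheet s t -> sheet s t' -> stab_charge t = stab_charge t' -> t = t'.
Proof.
move=> [_ [_ b]] [_ [_ b']] e; apply: stab_unique => //.
apply: (@slicing_ballW _ _ (3^-1 + 3^-1)); first by lra.
exact: slicing_ball_triangle (slicing_ball_sym b) b'.
Qed.

Lemma sheet_homeo s : supported s -> stab_charge s = Z0 ->
  homeo_on (@stab_charge R D m v) (sheet s) base.
Proof.
move=> ss sZ.
(* The condition is put inside the existential to obtain a total section [g]; outside [base] the
   value [s] is a dummy. *)
have sur Z : exists t, base Z -> sheet s t /\ stab_charge t = Z.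
  have [[_ OZ]|nB] := pselect (base Z); last by exists s.
  have [t [tZ st bt]] := (Hd (close_refl Z0 (ltW d0))).2 _ _ (O_close OZ) ss sZ.
  exists t => _; split; last exact: tZ.
  split; first exact: st.
  split; last exact: bt.
  by rewrite -tZ in OZ.
have [g Hg] := choice sur.
split.
- split.
  + by move=> t [st [Ot _]]; split=> //; exact: st.1.
  + by move=> t t' /set_mem h /set_mem h'; exact: sheet_unique h h'.
  + by move=> Z /Hg[h1 h2]; exists (g Z).
- exact: continuous_subspaceT stab_charge_continuous.
exists g; split.
- apply/subspace_continuousP => Z bZ A /nbhs_stab[B [e [nB e0 HA]]].
  have [sg gZ] := Hg _ bZ; rewrite gZ in nB.
  (* The path from [g W] to [s], to [g Z], to the deformation [t] of [g Z] has three steps, each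
     below [1/3]; its length is below [1], and uniqueness gives [g W = t]. *)
  pose e' := Num.min e 3^-1.
  have e'0 : 0 < e' by rewrite lt_min e0 invr_gt0 ltr0n.
  have [d' d'0 H] := deform_stab bZ.1 e'0.
  rewrite /= /within /=; apply: filterS (filterI nB (nbhs_close Z d'0)) => W [BW cW] bW.
  have [sgW gW] := Hg _ bW.
  have [t [tW st bt]] := (H _ (close_refl Z (ltW d'0))).2 _ _ cW sg.1 gZ.
  suff eW : g W = t.
    change (A (g W)); rewrite eW; apply: HA; first by rewrite tW.
    by apply: slicing_ballW bt; rewrite ge_min lexx.
  apply: stab_unique; first by rewrite gW tW.
  have [_ [_ b1]] := sg; have [_ [_ b2]] := sgW.
  have b3 := slicing_ball_triangle (slicing_ball_sym b2) b1.
  have b4 := slicing_ball_triangle b3 bt.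
  apply: slicing_ballW b4; have : e' <= 3^-1 by rewrite ge_min lexx orbT.
  by lra.
- by move=> Z /set_mem /Hg[].
- move=> t /set_mem h; have bt : base (stab_charge t).
    by case: h => st [Ot _]; split=> //; exact: st.1.
  have [h1 h2] := Hg _ bt; exact: sheet_unique h1 h h2.
Qed.

(** The sheets are indexed by the fibre over [Z0]. A supported point over the box is deformed back
    to [Z0], which finds the centre of its sheet; two sheets sharing a point have centres within
    [2/3] over the same charge. *)
Lemma sheets_evenly_cover : evenly_covered (@stab_charge R D m v) supported base.
Proof.
exists [set S | exists s, [/\ supported s, stab_charge s = Z0 & S = sheet s]]; split.
- move=> S S' [s [ss sZ ->]] [s' [ss' sZ' ->]] [t [h h']].
  have [_ [_ b]] := h; have [_ [_ b']] := h'.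
  suff -> : s = s' by [].
  apply: stab_unique; first by rewrite sZ sZ'.
  apply: (@slicing_ballW _ _ (3^-1 + 3^-1)); first by lra.
  exact: slicing_ball_triangle b (slicing_ball_sym b').
- apply/seteqP; split=> [t [S [s [ss sZ ->]]] [st [Ot _]]|t [st [_ Ot]]].
    by split=> //; split=> //; exact: st.1.
  have [s [sZ ss b]] := (Hd (O_close Ot)).2 _ _ (close_refl Z0 (ltW d0)) st erefl.
  exists (sheet s); first by exists s.
  by split=> //; split=> //; exact: slicing_ball_sym.
- move=> S [s [ss sZ ->]]; split; last exact: sheet_homeo.
  exists (sheet_nbhs s) => //; apply: openI.
    by apply: open_comp => [t _|]; [exact: stab_charge_continuous|exact: open_interior].
  by apply: open_comp => [t _|]; [exact: stab_slicing_continuous|exact: open_slicing_ball].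
Qed.

End Sheet.
End Topology.

Theorem theorem1p2 (R : realType) (D : triangulated) (m : nat)
    (v : {additive Kgroup D -> 'rV[int]_m})
    (Q : 'rV[R]_m -> R) (hQ : is_quadratic_form Q)
    (sigma : stab R v)
    (hsigma : support_property v Q (stab_charge sigma) (stab_slicing sigma)) :
  exists U : set (stab R v),
    [/\ open_nbhs sigma U,
        covering_on (@stab_charge R D m v) U
          [set Z' : 'cV[R[i]]_m | neg_def_on_ker Q Z']
      & forall tau, U tau ->
          support_property v Q (stab_charge tau) (stab_slicing tau)].
Proof.
exists (supported Q); split=> //; first by split=> //; exact: open_supported.
split.
- exact/continuous_subspaceT/stab_charge_continuous.
- by move=> _ [s ss <-]; exact: ss.1.
- move=> Z nZ; have e0 : 0 < (3^-1 : R) by rewrite invr_gt0 ltr0n.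
  have [d d0 H] := deform_stab v hQ nZ e0.
  exists (charge_close d Z)^°; last exact: sheets_evenly_cover.
  split; first exact: open_interior.
  exact: nbhs_close.
Qed.
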